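(* Let $\varphi$ be an Orlicz function satisfying the condition $\delta_2$ and let $w$ be a weight sequence. Let $\lambda_{\varphi,w}$ be the Orlicz–Lorentz sequence space. Then the Shilov boundaries $\partial\mathcal{A}_u(B_{\lambda_{\varphi,w}})$ and $\partial\mathcal{A}_b(B_{\lambda_{\varphi,w}})$ exist and $$\partial\mathcal{A}_u(B_{\lambda_{\varphi,w}})=\partial\mathcal{A}_b(B_{\lambda_{\varphi,w}})=S_{\lambda_{\varphi,w}}.$$
   Context: For a complex Banach space $X$, $B_X$ is the closed unit ball and $S_X$ the unit sphere. $\mathcal{A}_b(B_X)$ is the Banach algebra (sup norm) of all bounded continuous functions $f:B_X\to\mathbb{C}$ that are holomorphic on the interior of $B_X$; $\mathcal{A}_u(B_X)$ is the subalgebra of those $f\in\mathcal{A}_b(B_X)$ that are uniformly continuous on $B_X$. A set $F\subset B_X$ is a boundary for an algebra $\mathcal{A}$ of bounded continuous functions on $B_X$ if $\sup_{x\in B_X}|f(x)|=\sup_{x\in F}|f(x)|$ for all $f\in\mathcal{A}$. If the intersection of all closed boundaries for $\mathcal{A}$ is again a boundary for $\mathcal{A}$, it is called the Shilov boundary for $\mathcal{A}$, denoted $\partial\mathcal{A}$. An Orlicz function is a function $\varphi:\mathbb{R}\to[0,\infty]$ that is even, convex, continuous and vanishes only at zero. It satisfies condition $\delta_2$ ($\varphi\in\delta_2$) if there exist $K>0$ and $u_0>0$ such that $\varphi(u_0)>0$ and $\varphi(2u)\le K\varphi(u)$ for all $u\in[0,u_0]$. A weight sequence $w=\{w(n)\}$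 is a non-increasing sequence of positive real numbers with $\sum_{n=1}^\infty w(n)=\infty$. For a complex sequence $x$, $x^*$ is the decreasing rearrangement of $|x|=\{|x(k)|\}$, i.e. $x^*(n)=\inf\{s\ge0:\ \mathrm{card}\{k:|x(k)|>s\}\le n-1\}$. With $\varrho_\varphi(x)=\sum_{n=1}^\infty\varphi(x^*(n))w(n)$, the Orlicz–Lorentz sequence space $\lambda_{\varphi,w}$ consists of all complex sequences $x$ such that $\varrho_\varphi(\lambda x)<\infty$ for some $\lambda>0$, with norm $\|x\|=\inf\{\lambda>0:\varrho_\varphi(x/\lambda)\le1\}$; it is a Banach space. *)

(* Defs.v *)
From HB Require Import structures.
From mathcomp Require Import all_boot all_order all_algebra.
From mathcomp Require Import all_classical all_reals all_analysis.
From mathcomp Require Import complex.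
From mathcomp Require Import zify ring lra.

Set Implicit Arguments.
Unset Strict Implicit.
Unset Printing Implicit Defensive.

Import Order.TTheory GRing.Theory Num.Theory.
Import numFieldNormedType.Exports.

Local Open Scope classical_set_scope.
Local Open Scope card_scope.
Local Open Scope ring_scope.
Local Open Scope complex_scope.

(* The R-valued modulus; on R[i] the norm `|z| is R[i]-valued, `|z| = (cabs z)%:C. *)
Notation cabs := ComplexField.Normc.normc.

Section shilov.
Context {R : realType} {X : normedModType R[i]}.

Definition closed_unit_ball : set X := [set x | `|x| <= 1].

Definition unit_sphere : set X := [set x | `|x| = 1].

(* A function on the ball is represented by a total function on X; the
   definitions below depend only on its values on the ball.  [differentiable]
   is Frechet differentiability over the complex scalars, i.e. holomorphy. *)
Definition algebra_b : set (X -> R[i]^o) :=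
  [set f | [/\ {within closed_unit_ball, continuous f},
               [bounded f x | x in closed_unit_ball]
             & forall x, closed_unit_ball° x -> differentiable f x]].

Definition algebra_u : set (X -> R[i]^o) :=
  algebra_b `&`
  [set f | unif_continuous (f : subspace closed_unit_ball -> R[i]^o)].

Definition is_boundary (A : set (X -> R[i]^o)) (F : set X) :=
  F `<=` closed_unit_ball /\
  forall f, A f ->
    ereal_sup [set (cabs (f x))%:E | x in closed_unit_ball] =
    ereal_sup [set (cabs (f x))%:E | x in F].

Definition shilov (A : set (X -> R[i]^o)) : set X :=
  \bigcap_(F in [set F | closed F /\ is_boundary A F]) F.

Definition shilov_exists (A : set (X -> R[i]^o)) := is_boundary A (shilov A).

End shilov.

Arguments closed_unit_ball {R} X.
Arguments unit_sphere {R} X.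
Arguments algebra_b {R} X.
Arguments algebra_u {R} X.

Record orlicz_function (R : realType) := OrliczFunction {
  orlicz_fun :> R -> \bar R ;
  orlicz_ge0 : forall u, (0 <= orlicz_fun u)%E ;
  orlicz_even : forall u, orlicz_fun (- u) = orlicz_fun u ;
  orlicz_convex : forall u v t, 0 <= t <= 1 ->
    (orlicz_fun (t * u + (1 - t) * v)%R
       <= t%:E * orlicz_fun u + (1 - t)%:E * orlicz_fun v)%E ;
  orlicz_continuous : continuous orlicz_fun ;
  orlicz_eq0 : forall u, orlicz_fun u = 0%E <-> u = 0 }.

Definition delta2 {R : realType} (phi : orlicz_function R) :=
  exists K u0 : R, [/\ 0 < K, 0 < u0, (0 < phi u0)%E &
    forall u, 0 <= u <= u0 -> (phi (2 * u)%R <= K%:E * phi u)%E].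

Record weight_sequence (R : realType) := WeightSequence {
  weight :> nat -> R ;
  weight_gt0 : forall n, 0 < weight n ;
  weight_nonincreasing : forall m n, (m <= n)%N -> weight n <= weight m ;
  weight_sum : (\sum_(0 <= n <oo) (weight n)%:E = +oo)%E }.

Section modular.
Context {R : realType}.
Implicit Types (x : nat -> R[i]) (n : nat).

(* Sequences are indexed from 0, so [rearrangement x n] is x^*(n + 1); its value
   is +oo when no s is admissible, that is when x is unbounded. *)
Definition rearrangement x n : \bar R :=
  ereal_inf [set s%:E | s in
    [set s : R | 0 <= s /\ [set k | s < cabs (x k)] #<= `I_n]].

(* The extension phi(+oo) := +oo is the limit of phi at +oo. *)
Definition orlicz_ext (phi : orlicz_function R) (a : \bar R) : \bar R :=
  if a is r%:E then phi r else +oo%E.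

Definition modular (phi : orlicz_function R) (w : weight_sequence R) x
    : \bar R :=
  (\sum_(0 <= n <oo) orlicz_ext phi (rearrangement x n) * (w n)%:E)%E.

Definition orlicz_lorentz_set (phi : orlicz_function R) (w : weight_sequence R)
    : set (nat -> R[i]) :=
  [set x | exists2 l : R, 0 < l & (modular phi w (l%:C *: x) < +oo)%E].

Definition luxemburg_norm (phi : orlicz_function R) (w : weight_sequence R) x
    : R :=
  inf [set l : R | 0 < l /\ (modular phi w ((l^-1)%:C *: x) <= 1)%E].

End modular.

Section modular_theory.
Context {R : realType} (phi : orlicz_function R) (w : weight_sequence R).
Implicit Types (x y : nat -> R[i]) (n : nat).

Lemma cabs_ge0 (z : R[i]) : 0 <= cabs z.
Proof. by case: z => a b; rewrite sqrtr_ge0. Qed.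

Lemma cabs_real (r : R) : 0 <= r -> cabs r%:C = r.
Proof.
by move=> r0; rewrite /cabs /= expr0n /= addr0 sqrtr_sqr ger0_norm.
Qed.

Lemma orlicz0 : phi 0 = 0%E. Proof. exact/orlicz_eq0. Qed.

Lemma orlicz_scale t u : 0 <= t <= 1 -> (phi (t * u)%R <= t%:E * phi u)%E.
Proof.
move=> t01; have := orlicz_convex phi u 0 t01.
by rewrite mulr0 addr0 orlicz0 mule0 adde0.
Qed.

Lemma orlicz_mono u v : 0 <= u -> u <= v -> (phi u <= phi v)%E.
Proof.
move=> u0 uv; have v0 : 0 <= v by exact: le_trans uv.
have [v00|vn0] := eqVneq v 0.
  by have -> : u = v by apply/le_anti; rewrite uv v00 u0.
have vp : 0 < v by rewrite lt_def vn0.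
have t01 : 0 <= u / v <= 1 by rewrite divr_ge0//= ler_pdivrMr// mul1r.
rewrite -[u in (phi u <= _)%E](divfK vn0); apply: le_trans (orlicz_scale v t01) _.
rewrite -[leRHS]mul1e; apply: lee_wpmul2r; first exact: orlicz_ge0.
by rewrite lee_fin; case/andP: t01.
Qed.

Lemma orlicz_ext_ge0 a : (0 <= orlicz_ext phi a)%E.
Proof. by case: a => [r||] //=; rewrite ?leey// orlicz_ge0. Qed.

Lemma orlicz_ext_mono (r : R) a :
  0 <= r -> (r%:E <= a)%E -> (phi r <= orlicz_ext phi a)%E.
Proof.
move=> r0; case: a => [s||] //=; rewrite ?leey// lee_fin => rs.
exact: orlicz_mono.
Qed.

Lemma rearrangement_ge0 x n : (0 <= rearrangement x n)%E.
Proof. by apply: le_ereal_inf_tmp => _ [s [s0 _] <-]; rewrite lee_fin. Qed.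

Lemma ge_rearrangement x n (sg : nat -> nat) (a : R) :
  {in `I_n.+1 &, injective sg} ->
  (forall i, (i <= n)%N -> a <= cabs (x (sg i))) ->
  (a%:E <= rearrangement x n)%E.
Proof.
move=> inj age; apply: le_ereal_inf_tmp => _ [s [s0 cs] <-]; rewrite lee_fin leNgt.
apply/negP => sa.
suff : `I_n.+1 #<= `I_n by rewrite card_le_II ltnn.
apply: card_le_trans cs.
apply: (card_le_trans (B := sg @` `I_n.+1)).
  by have := inj_card_eq inj; rewrite card_eq_sym card_eq_le => /andP[].
apply: subset_card_le => _ [i /= iN <-]; apply: lt_le_trans (age _ _) => //.
Qed.

Lemma lt_rearrangement x n s : 0 <= s -> (s%:E < rearrangement x n)%E ->
  ~ ([set k | s < cabs (x k)] #<= `I_n).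
Proof.
move=> s0 sx cs; move: sx; apply/negP; rewrite -leNgt.
by apply: ereal_inf_lbound; exists s.
Qed.

(* Systems of distinct representatives, chosen greedily. *)
Lemma select (E : nat -> set nat) N : (forall n, (n < N)%N -> ~ (E n #<= `I_n)) ->
  exists2 sg : nat -> nat, {in `I_N &, injective sg} &
    forall n, (n < N)%N -> E n (sg n).
Proof.
elim: N => [|N IH] EN.
  by exists id => // i j; rewrite inE.
have [n nN|sg inj Esg] := IH; first by apply: EN; rewrite ltnS ltnW.
have [k Ek nk] : exists2 k, E N k & ~ (sg @` `I_N) k.
  apply: contrapT => h; apply: (EN N (ltnSn _)).
  apply: card_le_trans (card_image_le sg _).
  by apply: subset_card_le => k Ek; apply: contrapT => nk; apply: h; exists k.
exists (fun n => if n == N then k else sg n).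
  move=> i j; rewrite !inE /= !ltnS => iN jN.
  have [->|iN'] := eqVneq i N; have [->|jN'] := eqVneq j N => //.
  - by move=> kj; case: nk; exists j => //=; rewrite ltn_neqAle jN'.
  - by move=> kj; case: nk; exists i => //=; rewrite ltn_neqAle iN'.
  - by apply: inj; rewrite inE /= ltn_neqAle ?iN' ?jN'.
move=> n; rewrite ltnS; have [->//|nN nN'] := eqVneq n N.
by apply: Esg; rewrite ltn_neqAle nN.
Qed.

Lemma swap_le (a b : \bar R) (v u : R) : (0 <= a)%E -> (a <= b)%E -> 0 < u ->
  u <= v -> (a * v%:E + b * u%:E <= b * v%:E + a * u%:E)%E.
Proof.
move=> a0 ab u0 uv; have v0 := lt_le_trans u0 uv.
case: a b a0 ab => [a||] [b||]//.
- by rewrite !lee_fin => a0 ab; nra.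
- move=> a0 _; rewrite [X in (_ <= X + _)%E]gt0_mulye ?lte_fin//.
  by rewrite addye ?leey// -EFinM.
Qed.

Lemma sum_le_rearrangement x (sg : nat -> nat) N : {in `I_N &, injective sg} ->
  (\sum_(n < N) phi (cabs (x (sg n))) * (w n)%:E <=
   \sum_(n < N) orlicz_ext phi (rearrangement x n) * (w n)%:E)%E.
Proof.
elim: N sg => [|N IH] sg inj; first by rewrite !big_ord0.
pose f (i : 'I_N.+1) := cabs (x (sg i)).
have [m mmin] : exists m : 'I_N.+1, forall i, f m <= f i.
  by case: (@Order.TotalTheory.arg_minP _ _ _ ord0 xpredT f isT) => m _ h;
     exists m => i; exact: h.
pose tg n := if n == N then sg m else if n == m then sg N else sg n.
have tginj : {in `I_N.+1 &, injective tg}.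
  move=> i j; rewrite !inE /= => iN jN; rewrite /tg.
  have mN := ltn_ord m.
  have sgE p q : (p < N.+1)%N -> (q < N.+1)%N -> sg p = sg q -> p = q.
    by move=> pN qN; apply: inj; rewrite inE.
  have [iN1|iN1] := eqVneq i N; have [jN1|jN1] := eqVneq j N;
  have [im|im] := eqVneq i m; have [jm|jm] := eqVneq j m;
  move=> h; try (have {h} := sgE _ _ _ _ h); lia.
have tgle : (\sum_(n < N.+1) phi (cabs (x (sg n))) * (w n)%:E <=
   \sum_(n < N.+1) phi (cabs (x (tg n))) * (w n)%:E)%E.
  have [mN|mN] := eqVneq m ord_max.
    apply: lee_sum => i _; rewrite /tg mN /=.
    by case: (eqVneq (val i) N) => [->|].
  have mN' : (m < N)%N.
    by rewrite ltn_neqAle -ltnS ltn_ord andbT; apply: contra mN => /eqP h; exact/eqP/val_inj.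
  rewrite (bigD1 m)//= (bigD1 ord_max)/=; last by rewrite eq_sym.
  rewrite [leRHS](bigD1 m)//= [X in (_ <= _ + X)%E](bigD1 ord_max)/=; last by rewrite eq_sym.
  rewrite !addeA; apply: leeD.
    rewrite /tg eqxx (ltn_eqF mN') eqxx.
    apply: swap_le; rewrite ?orlicz_ge0 ?weight_gt0//.
      by apply: orlicz_mono (mmin ord_max); exact: cabs_ge0.
    by apply: weight_nonincreasing; exact: ltnW.
  apply: lee_sum => i /andP[im iN]; rewrite /tg.
  by rewrite !ifN.
apply: le_trans tgle _; rewrite !big_ord_recr/=; apply: leeD.
  apply: IH => i j; rewrite !inE /= => iN jN; apply: tginj; rewrite inE /=; exact: ltnW.
apply: lee_wpmul2r; first by rewrite lee_fin ltW// weight_gt0.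
rewrite /tg eqxx; apply: orlicz_ext_mono; first exact: cabs_ge0.
by apply: ge_rearrangement inj _ => i iN; exact: (mmin (Ordinal (iN : (i < N.+1)%N))).
Qed.

Lemma modular_term_ge0 x n :
  (0 <= orlicz_ext phi (rearrangement x n) * (w n)%:E)%E.
Proof. by rewrite mule_ge0 ?orlicz_ext_ge0// lee_fin ltW// weight_gt0. Qed.

Lemma modular_ge x N :
  (\sum_(n < N) orlicz_ext phi (rearrangement x n) * (w n)%:E <=
   modular phi w x)%E.
Proof.
rewrite -(big_mkord xpredT
  (fun n => orlicz_ext phi (rearrangement x n) * (w n)%:E)%E).
by apply: nneseries_lim_ge => n _ _; exact: modular_term_ge0.
Qed.

Lemma modular_le x B :
  (forall N, (\sum_(n < N) orlicz_ext phi (rearrangement x n) * (w n)%:E <= B)%E) ->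
  (modular phi w x <= B)%E.
Proof.
move=> xB; apply: lime_le.
  by apply: is_cvg_nneseries => n _ _; exact: modular_term_ge0.
by apply: nearW => N; rewrite big_mkord.
Qed.

Lemma orlicz_approx a : (0 <= a)%E -> exists s : nat -> R,
  (forall j, s j = 0 \/ 0 <= s j /\ ((s j)%:E < a)%E) /\
  phi (s j) @[j --> \oo] --> orlicz_ext phi a.
Proof.
case: a => [r||]//=.
  rewrite lee_fin le_eqVlt => /predU1P[<-|r0].
    by exists (fun=> 0); split; [left|exact: cvg_cst].
  exists (fun j => r - r * harmonic j); split.
    move=> j; right; split.
      rewrite subr_ge0 ler_piMr ?(ltW r0)// /harmonic /=.
      by rewrite invf_le1 ?ler1n ?ltr0n.
    by rewrite lte_fin ltrBlDr ltrDl mulr_gt0// /harmonic /= invr_gt0 ltr0n.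
  have h : r - r * harmonic j @[j --> \oo] --> r.
    rewrite -[X in _ --> X]subr0 -[X in _ --> _ - X](mulr0 r).
    by apply: cvgB; [exact: cvg_cst|apply: cvgMl_tmp; exact: cvg_harmonic].
  exact: cvg_comp h (@orlicz_continuous _ phi r).
move=> _; exists (fun j => j.+1%:R); split.
  by move=> j; right; rewrite ler0n ltry.
have p1 : (0 < phi 1%R)%E.
  rewrite lt0e orlicz_ge0 andbT; apply/eqP => /orlicz_eq0/eqP.
  by rewrite oner_eq0.
have le1 j : (j.+1%:R%:E * phi 1%R <= phi j.+1%:R%R)%E.
  have jp : (0 : R) < j.+1%:R by rewrite ltr0n.
  have := @orlicz_scale j.+1%:R^-1 j.+1%:R; rewrite mulVf ?gt_eqF//.
  rewrite invr_ge0 (ltW jp) invf_le1// ler1n => /(_ isT).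
  move=> /(lee_wpmul2l (x := j.+1%:R%:E)); rewrite lee_fin (ltW jp) => /(_ isT).
  by rewrite muleA -EFinM mulfV ?gt_eqF// mul1e.
apply/cvgeyPge => A.
case E1 : (phi 1) p1 le1 => [p||]// p1 le1.
  near=> j; apply: le_trans (le1 j).
  rewrite -EFinM lee_fin -ler_pdivrMr//.
  apply: (@le_trans _ _ j%:R); last by rewrite ler_nat.
  by near: j; exact: nbhs_infty_ger.
apply: nearW => j; apply: le_trans (le1 j).
by rewrite gt0_muley ?lte_fin ?ltr0n// leey.
Unshelve. all: by end_near. Qed.

Lemma modular_convex x y z t : 0 <= t <= 1 ->
  (forall k, cabs (z k) <= t * cabs (x k) + (1 - t) * cabs (y k)) ->
  (modular phi w z <= t%:E * modular phi w x + (1 - t)%:E * modular phi w y)%E.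
Proof.
move=> t01 zxy; have /andP[t0 t1] := t01.
have t1' : 0 <= 1 - t by rewrite subr_ge0.
apply: modular_le => N.
have /choice[s sP] n := orlicz_approx (rearrangement_ge0 z n).
have cv : (\sum_(n < N) phi (s n j) * (w n)%:E)%E @[j --> \oo] -->
    (\sum_(n < N) orlicz_ext phi (rearrangement z n) * (w n)%:E)%E.
  apply: cvg_nnesum => n _.
    by apply: nearW => j; rewrite mule_ge0 ?orlicz_ge0// lee_fin ltW ?weight_gt0.
  by apply: cvgeZr => //; exact: (sP n).2.
rewrite -(cvg_lim _ cv)//; apply: lime_le; first by apply/cvg_ex; eexists; exact: cv.
apply: nearW => j.
have s0 n : 0 <= s n j by case: ((sP n).1 j) => [->|[]].
have [sg inj sgP] : exists2 sg : nat -> nat, {in `I_N &, injective sg} &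
    forall n, (n < N)%N -> s n j <= cabs (z (sg n)).
  have [n nN|sg inj sgP] := @select (fun n => [set k | s n j <= cabs (z k)]) N.
    case: ((sP n).1 j) => [s00|[_ sz]].
      rewrite s00 (_ : [set _ | _] = setT); last first.
        by apply/seteqP; split => // k _ /=; exact: cabs_ge0.
      move=> h; have : `I_n.+1 #<= `I_n by apply: card_le_trans h; exact: subset_card_le.
      by rewrite card_le_II ltnn.
    move=> h; apply: (lt_rearrangement (s0 n) sz); apply: card_le_trans h.
    by apply: subset_card_le => k /= /ltW.
  by exists sg.
apply: (@le_trans _ _ (\sum_(n < N) (t%:E * (phi (cabs (x (sg n))) * (w n)%:E) +
   (1 - t)%:E * (phi (cabs (y (sg n))) * (w n)%:E))))%E.
  apply: lee_sum => n _; rewrite !muleA -ge0_muleDl ?mule_ge0 ?orlicz_ge0//.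
  apply: lee_wpmul2r; first by rewrite lee_fin ltW// weight_gt0.
  apply: le_trans (orlicz_convex phi _ _ t01); apply: orlicz_mono => //.
  by apply: le_trans (zxy _); exact: sgP.
have nn (u : nat -> R[i]) (n : 'I_N) : (0 <= phi (cabs (u (sg n))) * (w n)%:E)%E.
  by rewrite mule_ge0 ?orlicz_ge0// lee_fin ltW// weight_gt0.
rewrite big_split/=; apply: leeD.
  rewrite -ge0_sume_distrr//; apply: lee_wpmul2l; first by rewrite lee_fin.
  by apply: le_trans (sum_le_rearrangement x inj) (modular_ge x N).
rewrite -ge0_sume_distrr//; apply: lee_wpmul2l; first by rewrite lee_fin.
by apply: le_trans (sum_le_rearrangement y inj) (modular_ge y N).
Qed.

Lemma modular_ge0 x : (0 <= modular phi w x)%E.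
Proof. by apply: nneseries_ge0 => n _ _; exact: modular_term_ge0. Qed.

Lemma cabsZ (a : R[i]) x k : cabs ((a *: x) k) = cabs a * cabs (x k).
Proof. exact: ComplexField.Normc.normcM. Qed.

Lemma cabsZr (a : R) x k : 0 <= a -> cabs ((a%:C *: x) k) = a * cabs (x k).
Proof. by move=> a0; rewrite cabsZ cabs_real. Qed.

Lemma modular0 : modular phi w 0 = 0%E.
Proof.
apply: eseries0 => n _ _; suff -> : rearrangement (0 : nat -> R[i]) n = 0%E.
  by rewrite /= orlicz0 mul0e.
apply/le_anti; rewrite rearrangement_ge0 andbT; apply: ereal_inf_lbound.
exists 0 => //; split => //; apply: subset_card_le => k.
have : cabs ((0 : nat -> R[i]) k) = 0 by exact: ComplexField.Normc.normc0.
by rewrite /mkset => ->; rewrite ltxx.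
Qed.

Lemma modular_scale x z t : 0 <= t <= 1 ->
  (forall k, cabs (z k) <= t * cabs (x k)) ->
  (modular phi w z <= t%:E * modular phi w x)%E.
Proof.
move=> t01 zx; rewrite -[leRHS]adde0 -(mule0 (1 - t)%:E) -modular0.
apply: modular_convex => // k.
by rewrite [cabs (0 k)]ComplexField.Normc.normc0 mulr0 addr0.
Qed.

Lemma modular_mono x z : (forall k, cabs (z k) <= cabs (x k)) ->
  (modular phi w z <= modular phi w x)%E.
Proof.
move=> zx; rewrite -[leRHS]mul1e; apply: modular_scale => [|k].
  by rewrite ler01 lexx.
by rewrite mul1r.
Qed.

Lemma orlicz_le_modular x k : (phi (cabs (x k)) * (w 0)%:E <= modular phi w x)%E.
Proof.
apply: le_trans (modular_ge x 1).
have := @sum_le_rearrangement x (fun=> k) 1; rewrite !big_ord1; apply.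
by move=> i j; rewrite !inE /= !ltnS !leqn0 => /eqP -> /eqP ->.
Qed.

Definition lux_set x :=
  [set l : R | 0 < l /\ (modular phi w ((l^-1)%:C *: x) <= 1)%E].

Lemma lux_lb x : has_lbound (lux_set x).
Proof. by exists 0 => l [/ltW]. Qed.

Lemma lux_nonempty x : orlicz_lorentz_set phi w x -> lux_set x !=set0.
Proof.
case=> l l0; set M := modular _ _ _ => Moo.
have M0 : (0 <= M)%E by exact: modular_ge0.
have Mf : M = (fine M)%:E by rewrite fineK// ge0_fin_numE.
have f0 : 0 <= fine M by rewrite fine_ge0.
have M1 : 0 < fine M + 1 by rewrite ltr_wpDl.
exists ((fine M + 1) / l); split; first by rewrite divr_gt0.
apply: (@le_trans _ _ (((fine M + 1)^-1)%:E * M)%E).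
  apply: modular_scale => [|k].
    by rewrite invr_ge0 ltW//= invf_le1// lerDr.
  rewrite !cabsZr ?invr_ge0 ?divr_ge0 ?(ltW M1) ?(ltW l0)//.
  by rewrite invf_div mulrA [_^-1 * _]mulrC.
by rewrite Mf -EFinM lee_fin mulrC ler_pdivrMr// mul1r lerDl.
Qed.

Lemma lux_add x y l m : lux_set x l -> lux_set y m -> lux_set (x + y) (l + m).
Proof.
move=> [l0 xl] [m0 ym]; have lm0 : 0 < l + m by rewrite addr_gt0.
split=> //; pose t := l / (l + m).
have t1 : 1 - t = m / (l + m) by rewrite /t; field; rewrite gt_eqF.
have t01 : 0 <= t <= 1.
  by rewrite divr_ge0 ?(ltW l0) ?(ltW lm0)//= ler_pdivrMr// mul1r lerDl ltW.
have t1' : 0 <= 1 - t by rewrite subr_ge0; case/andP: t01.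
apply: (@le_trans _ _ (t%:E * modular phi w ((l^-1)%:C *: x) +
   (1 - t)%:E * modular phi w ((m^-1)%:C *: y))%E).
  apply: modular_convex => // k; rewrite !cabsZr ?invr_ge0 ?(ltW l0) ?(ltW m0) ?(ltW lm0)//.
  rewrite t1 /t !mulrA.
  have -> : l / (l + m) / l = (l + m)^-1 by field; rewrite !gt_eqF.
  have -> : m / (l + m) / m = (l + m)^-1 by field; rewrite !gt_eqF.
  rewrite -mulrDr ler_pM2l ?invr_gt0//.
  exact: le_normcD.
apply: (@le_trans _ _ (t%:E * 1 + (1 - t)%:E * 1)%E).
  by apply: leeD; apply: lee_wpmul2l => //; rewrite lee_fin//; case/andP: t01.
by rewrite !mule1 -EFinD lee_fin addrC subrK.
Qed.

Lemma lux_scale x l (a : R[i]) : a != 0 -> lux_set x l -> lux_set (a *: x) (cabs a * l).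
Proof.
move=> a0 [l0 xl].
have an0 : 0 < cabs a.
  rewrite lt_def cabs_ge0 andbT; apply: contra a0 => /eqP.
  by move=> /ComplexField.Normc.eq0_normc ->.
split; first by rewrite mulr_gt0.
apply: le_trans xl; apply: modular_mono => k.
rewrite cabsZr ?invr_ge0 ?mulr_ge0 ?(ltW l0) ?(ltW an0)// cabsZ.
rewrite cabsZr ?invr_ge0 ?(ltW l0)//.
by rewrite invfM mulrACA mulVf ?gt_eqF// mul1r.
Qed.

Lemma orlicz_lorentz_set0 : orlicz_lorentz_set phi w 0.
Proof. by exists 1 => //; rewrite scaler0 modular0 ltry. Qed.

Lemma lux_orlicz_lorentz x l : lux_set x l -> orlicz_lorentz_set phi w x.
Proof.
by move=> [l0 xl]; exists l^-1; rewrite ?invr_gt0//; exact: le_lt_trans xl (ltry _).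
Qed.

Lemma orlicz_lorentz_setD x y : orlicz_lorentz_set phi w x ->
  orlicz_lorentz_set phi w y -> orlicz_lorentz_set phi w (x + y).
Proof.
move=> /lux_nonempty[l xl] /lux_nonempty[m ym].
exact: lux_orlicz_lorentz (lux_add xl ym).
Qed.

Lemma orlicz_lorentz_setZ (a : R[i]) x : orlicz_lorentz_set phi w x ->
  orlicz_lorentz_set phi w (a *: x).
Proof.
have [->|a0] := eqVneq a 0; first by rewrite scale0r => _; exact: orlicz_lorentz_set0.
by move=> /lux_nonempty[l xl]; exact: lux_orlicz_lorentz (lux_scale a0 xl).
Qed.

Lemma luxemburg_normD x y : orlicz_lorentz_set phi w x ->
  orlicz_lorentz_set phi w y ->
  luxemburg_norm phi w (x + y) <= luxemburg_norm phi w x + luxemburg_norm phi w y.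
Proof.
move=> /lux_nonempty nx /lux_nonempty ny.
rewrite -lerBlDr; apply: lb_le_inf => // l xl.
rewrite lerBlDr -lerBlDl; apply: lb_le_inf => // m ym.
rewrite lerBlDl; apply: ge_inf; first exact: lux_lb.
exact: lux_add.
Qed.

Lemma luxemburg_norm0 : luxemburg_norm phi w 0 = 0.
Proof.
have z l : 0 < l -> lux_set 0 l by move=> l0; split=> //; rewrite scaler0 modular0.
apply/le_anti/andP; split.
  apply/ler_addgt0Pl => e e0; rewrite addr0; apply: ge_inf (lux_lb _) _ _.
  exact: z.
by apply: lb_le_inf => [|l [/ltW]//]; exists 1; exact: z.
Qed.

Lemma luxemburg_norm_leZ (a : R[i]) x : a != 0 -> orlicz_lorentz_set phi w x ->
  luxemburg_norm phi w (a *: x) <= cabs a * luxemburg_norm phi w x.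
Proof.
move=> a0 /lux_nonempty nx.
have an0 : 0 < cabs a.
  rewrite lt_def cabs_ge0 andbT; apply: contra a0 => /eqP.
  by move=> /ComplexField.Normc.eq0_normc ->.
rewrite mulrC -ler_pdivrMr//; apply: lb_le_inf => // l xl.
rewrite ler_pdivrMr// mulrC; apply: ge_inf (lux_lb _) _ _.
exact: lux_scale.
Qed.

Lemma luxemburg_normZ (a : R[i]) x : orlicz_lorentz_set phi w x ->
  luxemburg_norm phi w (a *: x) = cabs a * luxemburg_norm phi w x.
Proof.
move=> xl; have [->|a0] := eqVneq a 0.
  by rewrite scale0r luxemburg_norm0 ComplexField.Normc.normc0 mul0r.
apply/le_anti; rewrite luxemburg_norm_leZ//=.
have := luxemburg_norm_leZ (invr_neq0 a0) (orlicz_lorentz_setZ a xl).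
rewrite scalerA mulVf// scale1r ComplexField.Normc.normcV.
have an0 : 0 < cabs a.
  rewrite lt_def cabs_ge0 andbT; apply: contra a0 => /eqP.
  by move=> /ComplexField.Normc.eq0_normc ->.
by rewrite mulrC ler_pdivlMr// mulrC.
Qed.

Lemma luxemburg_norm_eq0 x : orlicz_lorentz_set phi w x ->
  luxemburg_norm phi w x = 0 -> x = 0.
Proof.
move=> xl x0; apply/funext => k; apply: ComplexField.Normc.eq0_normc.
apply/eqP; apply: contraT => xk0.
have p0 : (0 < phi (cabs (x k)))%E.
  by rewrite lt0e orlicz_ge0 andbT; apply: contra xk0 => /eqP/orlicz_eq0 ->.
have w0 := weight_gt0 w 0.
have [e e0 ep] : exists2 e : R, 0 < e & (e%:E < phi (cabs (x k)) * (w 0)%:E)%E.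
  case: (phi _) p0 => [p||]//.
    rewrite lte_fin => p0; exists (p * w 0 / 2); first by rewrite divr_gt0 ?mulr_gt0.
    by rewrite -EFinM lte_fin ltr_pdivrMr// mulr_natr mulr2n ltrDl mulr_gt0.
  by move=> _; exists 1 => //; rewrite gt0_mulye ?lte_fin// ltry.
pose d := Num.min e 1.
have d0 : 0 < d by rewrite lt_min e0 ltr01.
have [l [l0 ml] ld] : exists2 l, lux_set x l & l < d.
  have := inf_adherent d0 (conj (lux_nonempty xl) (lux_lb x)).
  by case=> l xl' lt; exists l => //; move: lt; rewrite [inf _]x0 add0r.
have l1 : l <= 1 by apply: le_trans (ltW ld) _; rewrite ge_min lexx orbT.
have le : l <= e by apply: le_trans (ltW ld) _; rewrite ge_min lexx.
suff : (phi (cabs (x k)) * (w 0)%:E <= l%:E)%E.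
  by move=> /(lt_le_trans ep); rewrite lte_fin ltNge le.
have := orlicz_le_modular ((l^-1)%:C *: x) k.
rewrite cabsZr ?invr_ge0 ?(ltW l0)// => /le_trans/(_ ml) h.
rewrite -[leRHS]mule1; apply: (@le_trans _ _ (l%:E * (phi (l^-1 * cabs (x k))%R * (w 0)%:E))%E).
  rewrite muleA; apply: lee_wpmul2r; first by rewrite lee_fin ltW.
  have := @orlicz_scale l (l^-1 * cabs (x k)); rewrite mulrA mulfV ?gt_eqF// mul1r.
  by apply; rewrite (ltW l0) l1.
by apply: lee_wpmul2l => //; rewrite lee_fin ltW.
Qed.

End modular_theory.

Section orlicz_lorentz.
Context {R : realType} (phi : orlicz_function R) (w : weight_sequence R).

Definition orlicz_lorentz_pred : {pred nat -> R[i]} :=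
  mem (orlicz_lorentz_set phi w).

Lemma orlicz_lorentz_submod_closed : submod_closed orlicz_lorentz_pred.
Proof.
split; first by rewrite inE; exact: orlicz_lorentz_set0.
move=> a x y /[!inE] xl yl; apply: orlicz_lorentz_setD => //.
exact: orlicz_lorentz_setZ.
Qed.

HB.instance Definition _ := GRing.isSubmodClosed.Build _ _ orlicz_lorentz_pred
  orlicz_lorentz_submod_closed.

Record orlicz_lorentz := OrliczLorentz {
  ol_seq :> nat -> R[i] ;
  ol_seqP : ol_seq \in orlicz_lorentz_pred }.

HB.instance Definition _ := [isSub for ol_seq].
HB.instance Definition _ := [Choice of orlicz_lorentz by <:].
HB.instance Definition _ := [SubChoice_isSubLmodule of orlicz_lorentz by <:].

Definition orlicz_lorentz_norm (x : orlicz_lorentz) : R[i] :=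
  (luxemburg_norm phi w x)%:C.

Lemma orlicz_lorentz_normD x y : orlicz_lorentz_norm (x + y) <=
  orlicz_lorentz_norm x + orlicz_lorentz_norm y.
Proof.
rewrite -rmorphD lecR; apply: luxemburg_normD; exact: set_mem (ol_seqP _).
Qed.

Lemma orlicz_lorentz_normZ (a : R[i]) x :
  orlicz_lorentz_norm (a *: x) = `|a| * orlicz_lorentz_norm x.
Proof.
rewrite /orlicz_lorentz_norm [`|a|](_ : _ = (cabs a)%:C) -?rmorphM; last first.
  by rewrite normc_def; case: a.
by congr _%:C; apply: luxemburg_normZ; exact: set_mem (ol_seqP _).
Qed.

Lemma orlicz_lorentz_norm_eq0 x : orlicz_lorentz_norm x = 0 -> x = 0.
Proof.
move=> /complexI x0; apply: val_inj; apply: luxemburg_norm_eq0 x0.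
exact: set_mem (ol_seqP _).
Qed.

HB.instance Definition _ := Lmodule_isNormed.Build R[i] orlicz_lorentz
  orlicz_lorentz_normD orlicz_lorentz_normZ orlicz_lorentz_norm_eq0.

Lemma orlicz_lorentz_normE (x : orlicz_lorentz) :
  `|x| = (luxemburg_norm phi w x)%:C.
Proof. by []. Qed.

End orlicz_lorentz.

(* Main.v *)
Require Import Defs.
From HB Require Import structures.
From mathcomp Require Import all_boot all_order all_algebra.
From mathcomp Require Import all_classical all_reals all_analysis.
From mathcomp Require Import complex.
From mathcomp Require Import zify ring lra.

(* The sphere is a boundary by the maximum modulus principle on complex lines
   through the origin.  The principle is proved without Cauchy's formula:
   Goursat's bisection gives a primitive P of the closed form Re (f dz), the
   difference quotients of P have a second order expansion with vanishing
   Laplacian, hence obey the maximum principle, and they tend to Re f.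

   Conversely, every closed boundary of A_u contains the sphere.  By delta_2 the
   finitely supported elements are dense in the sphere.  At such an element a,
   with a_1, a_2, ... its nonzero values in decreasing order of modulus, the
   slopes c_i > 0 of phi at |a_i|, weighted by w_i, give
   sum_i c_i (|x_i| - |a_i|) + tail(x) <= 0 on the unit ball.  For small eta > 0
   and large K the modulus of the quadratic polynomial
   K + sum_i (c_i u_i x_i - eta (u_i x_i - |a_i|)^2), where u_i a_i = |a_i| and
   |u_i| = 1, then peaks strongly at a: near its maximum x_i is close to a_i and
   tail(x) is small, so x is close to a by delta_2. *)

Set Implicit Arguments.
Unset Strict Implicit.
Unset Printing Implicit Defensive.

Import Order.TTheory GRing.Theory Num.Theory.
Import numFieldNormedType.Exports.

Local Open Scope classical_set_scope.
Local Open Scope ring_scope.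
Local Open Scope complex_scope.

(** * The maximum modulus principle *)

(** Holomorphy is given as bare differentiability, without continuity of the derivative, so Green's
    formula is out of reach and Goursat's bisection is forced. Passing to the primitive [P] gains
    one order: first order expansions of [A] and [B] become a second order expansion of [P], to
    which a discrete Laplacian applies, whereas [A] itself is not known to be twice differentiable.

    In the second half the obstacle is the rearrangement, which depends on all coordinates at once.
    The modular is instead treated as the supremum of sums of [phi (cabs (x (sg n))) * w n] over
    injections [sg], and estimates become concatenations of injections. Placing the support of [a],
    of size [m], first leaves the weights [w (m + j)] to the other coordinates; returning to the
    true weights costs a factor depending on [m], so [a] is taken finitely supported, and closedness
    of the boundary does the rest.

    The squares in the peak polynomial are there because the linear part may be maximal on a whole
    face of the ball, as in l_1. *)

Section primitive.
Context {R : realType}.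
Implicit Types (k : R -> R) (a p x : R).

(* A primitive of [k] on ]-2, 2[ only. *)
Definition prim k x : R := (\int[lebesgue_measure]_(t in `[(- 2), x]) k t)%R.

Lemma is_derive_prim k x : continuous k -> - 2 < x -> x < 2 ->
  is_derive x 1 (prim k) (k x).
Proof.
move=> ck x2 x2'.
have [|dF FE] := @continuous_FTC1_closed R k (- 2) x 2 x2' _ x2 (ck x).
  apply: continuous_compact_integrable; first exact: segment_compact.
  exact: continuous_subspaceT.
by apply: DeriveDef; [exact: dF | rewrite -derive1E FE].
Qed.

(** Oriented integral: [b < a] is allowed, so rectangles may have sides of either sign. *)
Definition oint k a b : R := prim k b - prim k a.

(** The affine function [u |-> al + be * u] has integral [al * p + be * (a * p + p ^+ 2 / 2)].
    Subtracting it and applying the mean value theorem to the integral up to [a + t * p] turns an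
    integral estimate into an estimate at one point. For [al = be = 0] this is the mean value
    theorem for integrals. *)
Lemma oint_affine k (al be a p : R) : continuous k -> -1 <= a <= 1 -> -1 <= a + p <= 1 ->
  exists2 t : R, 0 <= t <= 1 &
  oint k a (a + p) - (al * p + be * (a * p + p ^+ 2 / 2)) =
  p * (k (a + t * p) - (al + be * (a + t * p))).
Proof.
move=> ck a2 ap2.
pose G (t : R) := prim k (a + t * p) - (al * (t * p) + be * (a * (t * p) + (t * p) ^+ 2 / 2)).
have dG (t : R) : 0 <= t <= 1 ->
    is_derive t 1 G (p * (k (a + t * p) - (al + be * (a + t * p)))).
  move=> t01.
  have h : is_derive t 1 (fun t : R => a + t * p) p.
    by apply: is_derive_eq; rewrite /GRing.scale /=; lra.
  have dp : is_derive (a + t * p) 1 (prim k) (k (a + t * p)).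
    by apply: is_derive_prim => //; nra.
  have dc : is_derive t 1 (fun t : R => prim k (a + t * p)) (k (a + t * p) * p).
    exact: (@is_derive1_comp _ (prim k) (fun t : R => a + t * p) t _ _ dp h).
  by apply: is_derive_eq; rewrite /GRing.scale /=; field.
have [t||t t01] := @MVT_segment R G
  (fun t => p * (k (a + t * p) - (al + be * (a + t * p)))) 0 1 ler01.
- by rewrite in_itv => /andP[/ltW t0 /ltW t1]; apply: dG; rewrite t0.
- apply: derivable_within_continuous => t; rewrite in_itv /= => t01.
  exact: (@ex_derive _ _ _ _ _ _ _ (dG t t01)).
rewrite in_itv /= in t01 => Gt; exists t => //.
move: Gt; rewrite /G /oint !mul0r !mul1r !addr0 expr0n /=.
lra.
Qed.
End primitive.

(** * Goursat's theorem on rectangles *)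

Section goursat.
Context {R : realType} (A B : R -> R -> R).
Context (cA : forall y, continuous (A^~ y)) (cB : forall x, continuous (B x)).
Implicit Types (a c p q x y s t eps d : R).

(* Both the real form [A dx + B dy] and its conjugate are closed to first order
   at [(x, y)]: this says that [A - i B] is complex differentiable there. *)
Definition conj_diff x y := exists a b, forall eps : R, 0 < eps ->
  exists2 d : R, 0 < d & forall h k, `|h| < d -> `|k| < d ->
    `|A (x + h) (y + k) - (A x y + a * h + b * k)| <= eps * (`|h| + `|k|) /\
    `|B (x + h) (y + k) - (B x y + b * h - a * k)| <= eps * (`|h| + `|k|).

(** Circulation of [A dx + B dy] around the rectangle with corner [(a, c)] and signed sides [p] and
    [q]. *)
Definition circ a c p q :=
  oint (A^~ c) a (a + p) + oint (B (a + p)) c (c + q)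
  - oint (A^~ (c + q)) a (a + p) - oint (B a) c (c + q).

Let half_add a p : a + p / 2 + p / 2 = a + p. Proof. lra. Qed.

(** The contributions of the inner edges cancel, so the circulation is the sum over the four
    quarters, one of which carries at least a quarter of it. *)
Lemma circ_bisect a c p q : exists i j : bool,
  `|circ a c p q| <=
    4 * `|circ (a + i%:R * (p / 2)) (c + j%:R * (q / 2)) (p / 2) (q / 2)|.
Proof.
have E : circ a c p q =
    circ a c (p / 2) (q / 2) + circ (a + p / 2) c (p / 2) (q / 2) +
    circ a (c + q / 2) (p / 2) (q / 2) +
    circ (a + p / 2) (c + q / 2) (p / 2) (q / 2).
  by rewrite /circ /oint !half_add; ring.
apply: contrapT => h.
have {}h (i j : bool) : 4 * `|circ (a + i%:R * (p / 2)) (c + j%:R * (q / 2)) (p / 2) (q / 2)|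
    < `|circ a c p q|.
  by rewrite ltNge; apply/negP => hij; apply: h; exists i, j.
have := h false false; have := h false true; have := h true false.
have := h true true; rewrite {h} /= !mul0r !mul1r !addr0.
have := ler_normD (circ a c (p / 2) (q / 2) + circ (a + p / 2) c (p / 2) (q / 2) +
    circ a (c + q / 2) (p / 2) (q / 2)) (circ (a + p / 2) (c + q / 2) (p / 2) (q / 2)).
have := ler_normD (circ a c (p / 2) (q / 2) + circ (a + p / 2) c (p / 2) (q / 2))
    (circ a (c + q / 2) (p / 2) (q / 2)).
have := ler_normD (circ a c (p / 2) (q / 2)) (circ (a + p / 2) c (p / 2) (q / 2)).
rewrite -E; lra.
Qed.

Let unit_in a p t : -1 <= a <= 1 -> -1 <= a + p <= 1 -> 0 <= t <= 1 ->
  -1 <= a + t * p <= 1.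
Proof. by move=> *; nra. Qed.

(** In [conj_diff] the same [b] is the [y]-slope of [A] and the [x]-slope of [B], so the first order
    parts have zero circulation. Only the errors on the four sides remain, each at most
    [eps * (|p| + |q|)] times the length of the side. *)
Lemma circ_local x y : conj_diff x y -> forall eps : R, 0 < eps ->
  exists2 d : R, 0 < d & forall a c p q s t,
    -1 <= a <= 1 -> -1 <= a + p <= 1 -> -1 <= c <= 1 -> -1 <= c + q <= 1 ->
    0 <= s <= 1 -> 0 <= t <= 1 -> x = a + s * p -> y = c + t * q ->
    `|p| + `|q| < d -> `|circ a c p q| <= 2 * eps * (`|p| + `|q|) ^+ 2.
Proof.
move=> [al [be xy]] eps eps0; have [d d0 xyd] := xy _ eps0.
exists d => // a c p q s t a1 ap1 c1 cq1 s01 t01 xE yE pqd.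
set L := `|p| + `|q| in pqd *.
have dist (u v r : R) : 0 <= u <= 1 -> 0 <= v <= 1 -> `|(v - u) * r| <= `|r|.
  move=> u01 v01; rewrite normrM ler_piMl//.
  by rewrite ler_norml; apply/andP; split; lra.
have L0 : 0 <= L by rewrite addr_ge0.
have near (r u : R) : 0 <= r <= 1 -> 0 <= u <= 1 ->
    `|A (a + r * p) (c + u * q) -
      (A x y + al * ((r - s) * p) + be * ((u - t) * q))| <= eps * L /\
    `|B (a + r * p) (c + u * q) -
      (B x y + be * ((r - s) * p) - al * ((u - t) * q))| <= eps * L.
  move=> r01 u01; have rp := dist s r p s01 r01; have uq := dist t u q t01 u01.
  have := xyd ((r - s) * p) ((u - t) * q).
  have -> : x + (r - s) * p = a + r * p by rewrite xE; ring.
  have -> : y + (u - t) * q = c + u * q by rewrite yE; ring.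
  case.
  - by apply: le_lt_trans rp (le_lt_trans _ pqd); rewrite lerDl.
  - by apply: le_lt_trans uq (le_lt_trans _ pqd); rewrite lerDr.
  have le : eps * (`|(r - s) * p| + `|(u - t) * q|) <= eps * L.
    by rewrite ler_wpM2l ?(ltW eps0)// lerD.
  by move=> h1 h2; split; [apply: le_trans h1 le|apply: le_trans h2 le].
have o0 : 0 <= (0 : R) <= 1 by rewrite lexx ler01.
have o1 : 0 <= (1 : R) <= 1 by rewrite lexx ler01.
(* On each side the affine function is the first order expansion of [A] or [B] at [(x, y)],
   restricted to that side. *)
have [t1 t101 E1] := oint_affine (A x y - al * x + be * (c - y)) al (@cA c) a1 ap1.
have [t2 t201 E2] := oint_affine (B x y + be * (a + p - x) + al * y) (- al) (@cB (a + p)) c1 cq1.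
have [t3 t301 E3] := oint_affine (A x y - al * x + be * (c + q - y)) al (@cA (c + q)) a1 ap1.
have [t4 t401 E4] := oint_affine (B x y + be * (a - x) + al * y) (- al) (@cB a) c1 cq1.
have [n1 _] := near _ _ t101 o0; have [_ n2] := near _ _ o1 t201.
have [n3 _] := near _ _ t301 o1; have [_ n4] := near _ _ o0 t401.
rewrite !mul0r !mul1r !addr0 in n1 n2 n3 n4.
set e1 := A _ _ - _ in n1; set e2 := B _ _ - _ in n2.
set e3 := A _ _ - _ in n3; set e4 := B _ _ - _ in n4.
have -> : circ a c p q = p * e1 + q * e2 - p * e3 - q * e4.
  rewrite /circ.
  have := E1; have := E2; have := E3; have := E4.
  have -> : A (a + t1 * p) c = e1 + (A x y + al * ((t1 - s) * p) + be * ((0 - t) * q)).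
    by rewrite /e1; ring.
  have -> : B (a + p) (c + t2 * q) = e2 + (B x y + be * ((1 - s) * p) - al * ((t2 - t) * q)).
    by rewrite /e2; ring.
  have -> : A (a + t3 * p) (c + q) = e3 + (A x y + al * ((t3 - s) * p) + be * ((1 - t) * q)).
    by rewrite /e3; ring.
  have -> : B a (c + t4 * q) = e4 + (B x y + be * ((0 - s) * p) - al * ((t4 - t) * q)).
    by rewrite /e4; ring.
  rewrite xE yE => h4 h3 h2 h1.
  move/eqP: h1; rewrite subr_eq => /eqP ->.
  move/eqP: h2; rewrite subr_eq => /eqP ->.
  move/eqP: h3; rewrite subr_eq => /eqP ->.
  move/eqP: h4; rewrite subr_eq => /eqP ->.
  by field.
have b u v : `|v| <= eps * L -> `|u * v| <= `|u| * (eps * L).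
  by move=> vL; rewrite normrM ler_wpM2l.
have b1 := b p _ n1; have b2 := b q _ n2; have b3 := b p _ n3; have b4 := b q _ n4.
apply: le_trans (ler_normB _ _) _; apply: le_trans (lerD (ler_normB _ _) (lexx _)) _.
apply: le_trans (lerD (lerD (ler_normD _ _) (lexx _)) (lexx _)) _.
have -> : 2 * eps * L ^+ 2 = `|p| * (eps * L) + `|q| * (eps * L) + `|p| * (eps * L) + `|q| * (eps * L).
  by rewrite /L; ring.
by rewrite !lerD.
Qed.

Lemma nested_itv (s : nat -> R) :
  (forall n, s n <= s n.+1 /\ s n.+1 + 2^-1 ^+ n.+1 <= s n + 2^-1 ^+ n) ->
  exists sg : R, forall n, s n <= sg <= s n + 2^-1 ^+ n.
Proof.
move=> sS.
have mono m n : s m <= s (n + m)%N /\ s (n + m)%N + 2^-1 ^+ (n + m) <= s m + 2^-1 ^+ m.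
  elim: n => [//|n [IH1 IH2]]; have [h1 h2] := sS (n + m)%N.
  by rewrite addSn; split; [exact: le_trans h1|exact: le_trans h2 IH2].
have pow n : 0 <= 2^-1 ^+ n :> R by rewrite exprn_ge0// invr_ge0.
have le m n : s m <= s n + 2^-1 ^+ n.
  have [mn|/ltnW nm] := leqP m n.
    have [+ _] := mono m (n - m)%N; rewrite subnK// => h.
    by apply: le_trans h _; rewrite lerDl.
  have [_ +] := mono n (m - n)%N; rewrite subnK//; apply: le_trans.
  by rewrite lerDl.
have hs : has_sup (range s).
  by split; [exists (s 0%N); exists 0%N | exists (s 0%N + 2^-1 ^+ 0) => _ [m _ <-]].
exists (sup (range s)) => n; apply/andP; split.
  by apply: sup_upper_bound => //; exists n.
by apply: ge_sup => //; [exact: hs.1 | move=> _ [m _ <-]].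
Qed.

(** The corners are kept as parameters [z] in the unit square, which treats negative and zero sides
    uniformly. At stage [n] the circulation is at most [4 ^+ n] times that of a rectangle with sides
    scaled by [2^-1 ^+ n]; the quadratic bound of [circ_local] at the limit point absorbs the
    factor. *)
Theorem goursat a c p q :
  -1 <= a <= 1 -> -1 <= a + p <= 1 -> -1 <= c <= 1 -> -1 <= c + q <= 1 ->
  (forall s t : R, 0 <= s <= 1 -> 0 <= t <= 1 -> conj_diff (a + s * p) (c + t * q)) ->
  circ a c p q = 0.
Proof.
move=> a1 ap1 c1 cq1 diff.
pose C n (z : R * R) :=
  circ (a + z.1 * p) (c + z.2 * q) (p * 2^-1 ^+ n) (q * 2^-1 ^+ n).
have step (nz : nat * (R * R)) : exists z' : R * R, exists i j : bool,
    [/\ z'.1 = nz.2.1 + i%:R * 2^-1 ^+ nz.1.+1, z'.2 = nz.2.2 + j%:R * 2^-1 ^+ nz.1.+1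
      & `|C nz.1 nz.2| <= 4 * `|C nz.1.+1 z'|].
  case: nz => n z /=.
  have [i [j ij]] := circ_bisect (a + z.1 * p) (c + z.2 * q) (p * 2^-1 ^+ n) (q * 2^-1 ^+ n).
  exists (z.1 + i%:R * 2^-1 ^+ n.+1, z.2 + j%:R * 2^-1 ^+ n.+1), i, j; split=> //.
  rewrite /C /=; set r := 2^-1 ^+ n in ij *.
  have -> : 2^-1 ^+ n.+1 = r / 2 by rewrite exprSr.
  have -> : a + (z.1 + i%:R * (r / 2)) * p = a + z.1 * p + i%:R * (p * r / 2) by ring.
  have -> : c + (z.2 + j%:R * (r / 2)) * q = c + z.2 * q + j%:R * (q * r / 2) by ring.
  by rewrite (mulrA p) (mulrA q).
have [F FP] := choice step.
pose z := fix z n := if n is n'.+1 then F (n', z n') else (0, 0).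
have zS n := FP (n, z n).
have half n : 2^-1 ^+ n = 2^-1 ^+ n.+1 + 2^-1 ^+ n.+1 :> R.
  by rewrite exprS; field.
have pow n : 0 < 2^-1 ^+ n :> R by rewrite exprn_gt0// invr_gt0.
have [s sP] : exists s : R, forall n, (z n).1 <= s <= (z n).1 + 2^-1 ^+ n.
  apply: nested_itv => n; have [i [j [/= -> _ _]]] := zS n.
  have := pow n.+1; rewrite (half n); set u := 2^-1 ^+ _.
  by move=> u0; case: i => /=; split; lra.
have [t tP] : exists t : R, forall n, (z n).2 <= t <= (z n).2 + 2^-1 ^+ n.
  apply: nested_itv => n; have [i [j [/= _ -> _]]] := zS n.
  have := pow n.+1; rewrite (half n); set u := 2^-1 ^+ _.
  by move=> u0; case: j => /=; split; lra.
have zbd n : (0 <= (z n).1 /\ (z n).1 + 2^-1 ^+ n <= 1) /\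
    (0 <= (z n).2 /\ (z n).2 + 2^-1 ^+ n <= 1).
  elim: n => [|n IH]; first by rewrite /= !add0r expr0.
  have [i [j [/= -> -> _]]] := zS n.
  move: IH; have := pow n.+1; rewrite (half n); set u := 2^-1 ^+ _.
  by case: i; case: j => /=; lra.
have C0 n : `|circ a c p q| <= 4 ^+ n * `|C n (z n)|.
  elim: n => [|n IH]; first by rewrite /C /= !mul0r !addr0 expr0 !mulr1 mul1r.
  apply: le_trans IH _; rewrite exprSr -mulrA ler_wpM2l ?exprn_ge0//.
  by have [i [j [_ _]]] := zS n.
have s01 : 0 <= s <= 1 by have := sP 0%N; rewrite /= add0r expr0.
have t01 : 0 <= t <= 1 by have := tP 0%N; rewrite /= add0r expr0.
set L := `|p| + `|q|; have L0 : 0 <= L by rewrite addr_ge0.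
apply/eqP; rewrite -normr_le0; apply/ler_addgt0Pl => e e0; rewrite addr0.
(* Makes [2 * eps * L ^+ 2 <= e]; the [+ 1] covers [L = 0]. *)
pose eps := e / (2 * (L + 1) ^+ 2).
have L1 : 0 < L + 1 by rewrite ltr_wpDl.
have eps0 : 0 < eps by rewrite divr_gt0// mulr_gt0// exprn_gt0.
have [d d0 small] := circ_local (diff s t s01 t01) eps0.
have [n nd] : exists n, L * 2^-1 ^+ n < d.
  have : (2^-1 : R) ^+ n @[n --> \oo] --> 0.
    by apply: cvg_expr; rewrite ger0_norm ?invr_ge0// invf_lt1// ltr1n.
  move=> /cvgrPdist_lt/(_ (d / (L + 1)))/(_ (divr_gt0 d0 L1))[n _ /(_ n (leqnn n))].
  rewrite sub0r normrN ger0_norm ?(ltW (pow n))// ltr_pdivlMr// => h.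
  exists n; apply: le_lt_trans h; rewrite mulrC ler_wpM2l ?(ltW (pow n))// lerDl.
  exact: ler01.
apply: le_trans (C0 n) _.
have [[z1 z1'] [z2 z2']] := zbd n; have := sP n; have := tP n.
rewrite /C; set u := (z n).1 in z1 z1' *; set v := (z n).2 in z2 z2' *.
have := pow n; have -> : (4 : R) ^+ n = ((2^-1 ^+ n) ^+ 2)^-1.
  by rewrite -!exprVn invrK -exprM mulnC exprM; congr (_ ^+ _); ring.
set r := 2^-1 ^+ n in nd z1' z2' * => r0 tr sr.
have := small (a + u * p) (c + v * q) (p * r) (q * r) ((s - u) / r) ((t - v) / r).
have unit (w g l : R) : 0 <= w <= 1 -> -1 <= g <= 1 -> -1 <= g + l <= 1 ->
    -1 <= g + w * l <= 1 by move=> w01 g1 gl; exact: unit_in.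
have -> : a + u * p + p * r = a + (u + r) * p by ring.
have -> : c + v * q + q * r = c + (v + r) * q by ring.
have -> : a + u * p + (s - u) / r * (p * r) = a + s * p by field; rewrite gt_eqF.
have -> : c + v * q + (t - v) / r * (q * r) = c + t * q by field; rewrite gt_eqF.
have -> : `|p * r| + `|q * r| = L * r.
  by rewrite !normrM (ger0_norm (ltW r0)) -mulrDl.
move=> h; apply: (@le_trans _ _ ((r ^+ 2)^-1 * (2 * eps * (L * r) ^+ 2))).
  rewrite ler_wpM2l ?invr_ge0 ?exprn_ge0 ?(ltW r0)//; apply: h => //.
  - by apply: unit => //; lra.
  - by apply: unit => //; lra.
  - by apply: unit => //; lra.
  - by apply: unit => //; lra.
  - by rewrite divr_ge0 ?(ltW r0) ?ler_pdivrMr//=; lra.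
  - by rewrite divr_ge0 ?(ltW r0) ?ler_pdivrMr//=; lra.
have -> : (r ^+ 2)^-1 * (2 * eps * (L * r) ^+ 2) = eps * (2 * L ^+ 2).
  by field; rewrite gt_eqF.
rewrite /eps mulrAC ler_pdivrMr; last by rewrite mulr_gt0 ?exprn_gt0.
apply: ler_wpM2l; first exact: ltW.
by nra.
Qed.
End goursat.

(** * Maximum principle for the four-point Laplacian *)

Section max_principle.
Context {R : realType}.

Lemma sqr_norm_continuous : continuous (fun z : R * R => z.1 ^+ 2 + z.2 ^+ 2).
Proof.
move=> z; apply: cvgD.
  by apply: (cvg_comp fst (fun u : R => u ^+ 2)); [exact: cvg_fst|exact: exprn_continuous].
by apply: (cvg_comp snd (fun u : R => u ^+ 2)); [exact: cvg_snd|exact: exprn_continuous].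
Qed.

Lemma disc_compact (r : R) : 0 <= r ->
  compact [set z : R * R | z.1 ^+ 2 + z.2 ^+ 2 <= r ^+ 2].
Proof.
move=> r0.
apply: (subclosed_compact _ (compact_setX (@segment_compact _ (- r) r)
  (@segment_compact _ (- r) r))).
  apply: (@closed_comp _ _ (fun z : R * R => z.1 ^+ 2 + z.2 ^+ 2) [set u | u <= r ^+ 2]).
    move=> z _; exact: sqr_norm_continuous.
  exact: closed_le.
move=> [x y] /= h; split => /=; rewrite in_itv /=.
  by rewrite -ler_norml -ler_sqr ?nnegrE// real_normK ?num_real//; nra.
by rewrite -ler_norml -ler_sqr ?nnegrE// real_normK ?num_real//; nra.
Qed.

(** The four-point difference of [x ^+ 2 + y ^+ 2] is exactly [4 * t ^+ 2], so adding
    [ka * (x ^+ 2 + y ^+ 2)] to [W] makes the difference positive for small [t], which excludes an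
    interior maximum. The Lipschitz hypothesis gives the continuity by which the maximum is
    attained. *)
Lemma four_point_max_principle (W : R -> R -> R) (r L m : R) : 0 <= r ->
  (forall x y x' y', x ^+ 2 + y ^+ 2 <= r ^+ 2 -> x' ^+ 2 + y' ^+ 2 <= r ^+ 2 ->
    `|W x y - W x' y'| <= L * (`|x - x'| + `|y - y'|)) ->
  (forall x y, x ^+ 2 + y ^+ 2 < r ^+ 2 -> forall eps : R, 0 < eps ->
    exists2 d : R, 0 < d & forall t, 0 < t < d ->
    - (eps * t ^+ 2) <=
      W (x + t) y + W (x - t) y + W x (y + t) + W x (y - t) - 4 * W x y) ->
  (forall x y, x ^+ 2 + y ^+ 2 = r ^+ 2 -> W x y <= m) ->
  forall x y, x ^+ 2 + y ^+ 2 <= r ^+ 2 -> W x y <= m.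
Proof.
move=> r0 lip lap bd x y xy; apply/ler_addgt0Pr => e e0.
pose ka := e / (r ^+ 2 + 1).
have r1 : 0 < r ^+ 2 + 1 by rewrite ltr_wpDl ?exprn_ge0.
have ka0 : 0 < ka by rewrite divr_gt0.
have kar : ka * r ^+ 2 <= e.
  by rewrite /ka mulrAC ler_pdivrMr// ler_wpM2l ?(ltW e0)// lerDl.
pose D := [set z : R * R | z.1 ^+ 2 + z.2 ^+ 2 <= r ^+ 2].
pose V (z : R * R) := W z.1 z.2 + ka * (z.1 ^+ 2 + z.2 ^+ 2).
have [||[x1 y1] + Vmax] := @compact_EVT_max _ R V D _ (disc_compact r0).
- by exists (x, y).
- have cW : {within D, continuous (fun z : R * R => W z.1 z.2)}.
    apply/subspace_continuousP => -[a b] Dab; apply/cvgrPdist_le => e1 e10.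
    have d0 : 0 < e1 / (2 * (`|L| + 1)).
      by rewrite divr_gt0// mulr_gt0// ltr_wpDl.
    rewrite near_withinE.
    have : \forall z \near (a, b), ball (a, b) (e1 / (2 * (`|L| + 1))) z by exact: nbhsx_ballx.
    apply: filterS => -[a' b'] [/= h1 h2] Dab'.
    apply: le_trans (lip _ _ _ _ Dab Dab') _; rewrite /ball /= in h1 h2.
    apply: (@le_trans _ _ (`|L| * (`|a - a'| + `|b - b'|))).
      by rewrite ler_wpM2r ?addr_ge0// ler_norm.
    apply: (@le_trans _ _ ((`|L| + 1) * (e1 / (2 * (`|L| + 1)) + e1 / (2 * (`|L| + 1))))).
      by apply: ler_pM; rewrite ?addr_ge0// ?lerDl// lerD// ltW.
    by rewrite le_eqVlt; apply/orP; left; apply/eqP; field; rewrite gt_eqF// ltr_wpDl.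
  rewrite continuous_subspace_in => t tA; apply: cvgD; first exact: cW.
  have cS : {within D, continuous (fun z : R * R => z.1 ^+ 2 + z.2 ^+ 2)}.
    by apply: continuous_subspaceT; exact: sqr_norm_continuous.
  by apply: cvgMl_tmp; exact: cS.
rewrite inE /D /= => D1.
have [in1|] := ltP (x1 ^+ 2 + y1 ^+ 2) (r ^+ 2); last first.
  move=> r1'; have := Vmax (x, y); rewrite inE /D /= => /(_ xy).
  have E1 : x1 ^+ 2 + y1 ^+ 2 = r ^+ 2 by apply/le_anti; rewrite D1.
  rewrite /V /= E1; have := bd _ _ E1.
  have : 0 <= ka * (x ^+ 2 + y ^+ 2) by rewrite mulr_ge0 ?(ltW ka0)// addr_ge0// sqr_ge0.
  lra.
exfalso.
have [d d0 dP] := lap _ _ in1 _ ka0.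
pose g := r ^+ 2 - (x1 ^+ 2 + y1 ^+ 2).
have g0 : 0 < g by rewrite subr_gt0.
pose M := 2 * `|x1| + 2 * `|y1| + 1 + g.
have M0 : 0 < M by rewrite /M; have := normr_ge0 x1; have := normr_ge0 y1; lra.
(* [t * M <= g] keeps the four neighbours of [(x1, y1)] in the disc, [g] being the gap in squared
   radius. *)
pose t := Num.min (d / 2) (Num.min 1 (g / M)).
have t0 : 0 < t by rewrite !lt_min ltr01 !divr_gt0.
have td : t < d.
  by apply: (@le_lt_trans _ _ (d / 2)); [rewrite ge_min lexx|rewrite ltr_pdivrMr// mulr_natr mulr2n ltrDl].
have t1 : t <= 1 by rewrite /t !ge_min lexx orbT.
have tg : t * M <= g by rewrite -ler_pdivlMr// /t !ge_min lexx !orbT.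
have inD (u v : R) : `|u| <= t -> `|v| <= t -> u * v = 0 -> D (x1 + u, y1 + v).
  move=> ut vt uv; rewrite /D /=.
  have xu : x1 * u <= `|x1| * t.
    by apply: le_trans (ler_norm _) _; rewrite normrM ler_wpM2l.
  have yv : y1 * v <= `|y1| * t.
    by apply: le_trans (ler_norm _) _; rewrite normrM ler_wpM2l.
  have uv2 : u ^+ 2 + v ^+ 2 <= t.
    have sq w : `|w| <= t -> w ^+ 2 <= t.
      move=> wt; rewrite -real_normK ?num_real// expr2.
      by apply: le_trans (ler_wpM2l (normr_ge0 w) wt) _; rewrite ler_piMl ?(ltW t0)// (le_trans wt).
    by move/eqP: uv; rewrite mulf_eq0 => /orP[]/eqP ->; rewrite expr0n /= ?addr0 ?add0r sq.
  rewrite /M /g in tg; nra.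
have tn : `|t| <= t by rewrite ger0_norm// ltW.
have tnN : `|- t| <= t by rewrite normrN.
have z0 : `|0 : R| <= t by rewrite normr0 ltW.
have Vle u v : `|u| <= t -> `|v| <= t -> u * v = 0 ->
    V (x1 + u, y1 + v) <= V (x1, y1).
  by move=> ut vt uv; apply: Vmax; rewrite inE; exact: inD.
have := Vle t 0 tn z0 (mulr0 _); have := Vle (- t) 0 tnN z0 (mulr0 _).
have := Vle 0 t z0 tn (mul0r _); have := Vle 0 (- t) z0 tnN (mul0r _).
rewrite /V /= !addr0.
have := dP t; rewrite t0 td => /(_ isT).
have : 0 < ka * t ^+ 2 by rewrite mulr_gt0// exprn_gt0.
nra.
Qed.

End max_principle.

(** * Maximum principle for real parts of holomorphic functions *)

Section conj_diff_max.
Context {R : realType} (A B : R -> R -> R) (M : R).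
Context (cA : continuous (fun z : R * R => A z.1 z.2)).
Context (cB : forall x, continuous (B x)).
Context (bA : forall x y, `|A x y| <= M) (bB : forall x y, `|B x y| <= M).
Context (dAB : forall x y, x ^+ 2 + y ^+ 2 < 1 -> conj_diff A B x y).
Implicit Types (x y h t : R).

Let cA1 y : continuous (A^~ y).
Proof.
move=> x.
apply: (@continuous_comp _ _ _ (fun u : R => (u, y)) (fun z : R * R => A z.1 z.2) x).
  by apply: (@cvg_pair _ _ _ _ (nbhs x) (nbhs y)); [exact: cvg_id|exact: cvg_cst].
exact: cA.
Qed.

Let disc_in x y : x ^+ 2 + y ^+ 2 < 1 -> (-1 <= x <= 1) /\ (-1 <= y <= 1).
Proof. by move=> h; split; apply/andP; split; nra. Qed.

Lemma oint_bound (k : R -> R) a b : continuous k -> (forall u, `|k u| <= M) ->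
  -1 <= a <= 1 -> -1 <= b <= 1 -> `|oint k a b| <= M * `|b - a|.
Proof.
move=> ck kM a1 b1; have ba : b = a + (b - a) by rewrite addrC subrK.
have := @oint_affine _ k 0 0 a (b - a) ck a1; rewrite -ba => /(_ b1)[t _].
rewrite !mul0r !addr0 !subr0 => ->.
by rewrite normrM mulrC ler_wpM2r.
Qed.

(* On the unit disc this is a primitive of [A dx + B dy]. *)
Let P x y := oint (A^~ 0) 0 x + oint (B x) 0 y.

Lemma potential_dy x y y' : P x y' - P x y = oint (B x) y y'.
Proof. by rewrite /P /oint; ring. Qed.

(** [P] integrates along the horizontal axis, then vertically. Goursat on the rectangle between the
    axis and height [y], which lies in the disc by convexity of the square function, moves the
    horizontal path up to that height. *)
Lemma potential_dx x x' y : x ^+ 2 + y ^+ 2 < 1 -> x' ^+ 2 + y ^+ 2 < 1 ->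
  P x' y - P x y = oint (A^~ y) x x'.
Proof.
move=> xy xy'; have [x1 y1] := disc_in xy; have [x1' _] := disc_in xy'.
have xx : x' = x + (x' - x) by rewrite addrC subrK.
have : circ A B x 0 (x' - x) y = 0.
  apply: goursat; rewrite -?xx ?add0r//.
  - by rewrite lerN10 ler01.
  - move=> s t s01 t01; apply: dAB.
    have : (t * y) ^+ 2 <= y ^+ 2.
      rewrite exprMn ler_piMl ?sqr_ge0//; case/andP: t01 => t0 t1; nra.
    have : (x + s * (x' - x)) ^+ 2 <= (1 - s) * x ^+ 2 + s * x' ^+ 2.
      have : 0 <= s * (1 - s) * (x - x') ^+ 2.
        by case/andP: s01 => s0 s1; apply: mulr_ge0 (sqr_ge0 _); apply: mulr_ge0; rewrite ?subr_ge0.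
      by lra.
    have : s * (x' ^+ 2 + y ^+ 2) <= s * 1 by case/andP: s01 => s0 s1; rewrite ler_wpM2l// ltW.
    nra.
rewrite /circ -xx add0r /P => h; apply: subr0_eq; rewrite -[RHS]h /oint; ring.
Qed.

(** An L-shaped path whose corner takes the abscissa of smaller modulus stays in the disc. *)
Lemma potential_lipschitz x y x' y' :
  x ^+ 2 + y ^+ 2 < 1 -> x' ^+ 2 + y' ^+ 2 < 1 ->
  `|P x' y' - P x y| <= M * (`|x' - x| + `|y' - y|).
Proof.
move=> xy xy'; have [x1 y1] := disc_in xy; have [x1' y1'] := disc_in xy'.
rewrite mulrDr; have [le|le] := leP (x ^+ 2) (x' ^+ 2).
  have xy2 : x ^+ 2 + y' ^+ 2 < 1 by lra.
  have -> : P x' y' - P x y = oint (A^~ y') x x' + oint (B x) y y'.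
    by rewrite -(potential_dx xy2 xy') -potential_dy; ring.
  by apply: le_trans (ler_normD _ _) _; rewrite lerD// oint_bound.
have xy2 : x' ^+ 2 + y ^+ 2 < 1 by lra.
have -> : P x' y' - P x y = oint (A^~ y) x x' + oint (B x') y y'.
  by rewrite -(potential_dx xy xy2) -potential_dy; ring.
by apply: le_trans (ler_normD _ _) _; rewrite lerD// oint_bound.
Qed.

Let near_in x y : x ^+ 2 + y ^+ 2 < 1 -> exists2 d : R, 0 < d & forall u,
  `|u| < d -> (x + u) ^+ 2 + y ^+ 2 < 1 /\ x ^+ 2 + (y + u) ^+ 2 < 1.
Proof.
move=> xy; have [x1 y1] := disc_in xy.
pose g := 1 - (x ^+ 2 + y ^+ 2); have g0 : 0 < g by rewrite subr_gt0.
have g1 : g <= 1 by rewrite /g; have := sqr_ge0 x; have := sqr_ge0 y; lra.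
exists (g / 3); first by rewrite divr_gt0.
move=> u; rewrite ltr_norml => /andP[u1 u2].
by move: g0 g1 u1 u2; rewrite /g => *; split; nra.
Qed.

(** [P] has gradient [(A, B)], and [conj_diff] gives [A] the [x]-slope [a] and [B] the [y]-slope
    [- a]. First order terms cancel between opposite points; the second order terms are [a * t ^+ 2]
    horizontally and [- a * t ^+ 2] vertically. *)
Lemma potential_four_point x y : x ^+ 2 + y ^+ 2 < 1 ->
  forall eps : R, 0 < eps -> exists2 d : R, 0 < d & forall t, 0 < t < d ->
  `|P (x + t) y + P (x - t) y + P x (y + t) + P x (y - t) - 4 * P x y|
    <= eps * t ^+ 2.
Proof.
move=> xy eps eps0; have [a [b AB]] := dAB xy.
have [|d d0 dP] := AB (eps / 4); first by rewrite divr_gt0.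
have [d1 d10 d1P] := near_in xy.
exists (Num.min d d1) => [|t /andP[t0]]; first by rewrite lt_min d0.
rewrite lt_min => /andP[td td1].
have [x1 y1] := disc_in xy.
have near (s : R) : 0 <= s <= 1 -> forall u : R, `|u| = t ->
    `|A (x + s * u) y - (A x y + a * (s * u))| <= eps / 4 * t /\
    `|B x (y + s * u) - (B x y - a * (s * u))| <= eps / 4 * t.
  move=> s01 u ut; have su : `|s * u| <= t.
    by rewrite normrM ut ler_piMl ?(ltW t0)// ler_norml; apply/andP; split; lra.
  have e4 : eps / 4 * `|s * u| <= eps / 4 * t.
    by rewrite ler_wpM2l// divr_ge0// ltW.
  split.
    have [] := dP (s * u) 0 (le_lt_trans su td); first by rewrite normr0.
    by rewrite normr0 !mulr0 !addr0 => h _; apply: le_trans h e4.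
  have [] := dP 0 (s * u) _ (le_lt_trans su td); first by rewrite normr0.
  by rewrite normr0 !mulr0 !addr0 !add0r => _ h; apply: le_trans h e4.
have tn : `|t| = t by rewrite gtr0_norm.
have tnN : `|- t| = t by rewrite normrN.
have [xt yt] : (x + t) ^+ 2 + y ^+ 2 < 1 /\ x ^+ 2 + (y + t) ^+ 2 < 1.
  by apply: d1P; rewrite tn.
have [xt' yt'] : (x - t) ^+ 2 + y ^+ 2 < 1 /\ x ^+ 2 + (y - t) ^+ 2 < 1.
  by apply: d1P; rewrite tnN.
have [xt1 _] := disc_in xt; have [xt1' _] := disc_in xt'.
have [_ yt1] := disc_in yt; have [_ yt1'] := disc_in yt'.
have [s1 s101 E1] := oint_affine (A x y - a * x) a (@cA1 y) x1 xt1.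
have [s2 s201 E2] := oint_affine (A x y - a * x) a (@cA1 y) x1 xt1'.
have [s3 s301 E3] := oint_affine (B x y + a * y) (- a) (@cB x) y1 yt1.
have [s4 s401 E4] := oint_affine (B x y + a * y) (- a) (@cB x) y1 yt1'.
have [n1 _] := near _ s101 _ tn; have [n2 _] := near _ s201 _ tnN.
have [_ n3] := near _ s301 _ tn; have [_ n4] := near _ s401 _ tnN.
set e1 := A _ _ - _ in n1; set e2 := A _ _ - _ in n2.
set e3 := B _ _ - _ in n3; set e4 := B _ _ - _ in n4.
have -> : P (x + t) y + P (x - t) y + P x (y + t) + P x (y - t) - 4 * P x y =
    t * (e1 - e2 + e3 - e4).
  have -> : P (x + t) y + P (x - t) y + P x (y + t) + P x (y - t) - 4 * P x y =
      oint (A^~ y) x (x + t) + oint (A^~ y) x (x - t) +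
      oint (B x) y (y + t) + oint (B x) y (y - t).
    rewrite -(potential_dx xy xt) -(potential_dx xy xt') -!potential_dy; ring.
  move/eqP: E1; rewrite subr_eq => /eqP ->.
  move/eqP: E2; rewrite subr_eq => /eqP ->.
  move/eqP: E3; rewrite subr_eq => /eqP ->.
  move/eqP: E4; rewrite subr_eq => /eqP ->.
  by rewrite /e1 /e2 /e3 /e4; field.
rewrite normrM tn expr2 mulrA mulrC ler_wpM2r ?(ltW t0)//.
apply: le_trans (ler_normB _ _) _; apply: le_trans (lerD (ler_normD _ _) (lexx _)) _.
apply: le_trans (lerD (lerD (ler_normB _ _) (lexx _)) (lexx _)) _.
have -> : eps * t = eps / 4 * t + eps / 4 * t + eps / 4 * t + eps / 4 * t by field.
by rewrite !lerD.
Qed.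

(* The difference quotients of [P] obey the maximum principle, and tend to [A]. *)
Theorem conj_diff_max_principle (m : R) :
  (forall x y, x ^+ 2 + y ^+ 2 = 1 -> A x y <= m) ->
  forall x y, x ^+ 2 + y ^+ 2 < 1 -> A x y <= m.
Proof.
move=> bd x0 y0 xy0; apply/ler_addgt0Pr => e e0.
pose D := [set z : R * R | z.1 ^+ 2 + z.2 ^+ 2 <= 1 ^+ 2].
(* [P] is controlled in the open disc only, so the bound on the circle has to be moved inwards: the
   compact set [K] misses the circle, hence lies in a smaller disc, and [A <= m + e] on the annulus
   outside it. *)
pose K := D `&` [set z : R * R | m + e <= A z.1 z.2].
have cK : compact K.
  apply: (subclosed_compact _ (disc_compact ler01)) => [|z []//].
  apply: closedI.
    apply: (@closed_comp _ _ (fun z : R * R => z.1 ^+ 2 + z.2 ^+ 2) [set u | u <= 1 ^+ 2]).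
      by move=> z _; exact: sqr_norm_continuous.
    exact: closed_le.
  apply: (@closed_comp _ _ (fun z : R * R => A z.1 z.2) [set u | m + e <= u]).
    by move=> z _; exact: cA.
  exact: closed_ge.
have [K0|/set0P/negP/negPn/eqP K0] := pselect (K !=set0); last first.
  rewrite leNgt; apply/negP => /ltW h.
  have : K (x0, y0) by split => //; rewrite /D /= expr1n ltW.
  by rewrite K0.
have [|[xc yc] + cmax] := @compact_EVT_max _ R (fun z : R * R => z.1 ^+ 2 + z.2 ^+ 2) K K0 cK.
  by apply: continuous_subspaceT; exact: sqr_norm_continuous.
rewrite inE => -[]; rewrite /D /= expr1n => c1 cA'.
set rho := xc ^+ 2 + yc ^+ 2 in c1 cmax.
have rho1 : rho < 1.
  rewrite lt_neqAle c1 andbT; apply/eqP => /bd; lra.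
have rho0 : 0 <= rho by rewrite addr_ge0 ?sqr_ge0.
pose rz := x0 ^+ 2 + y0 ^+ 2.
have rz1 : rz < 1 by [].
have rz0 : 0 <= rz by rewrite addr_ge0 ?sqr_ge0.
(* The two terms are at least the square roots of [rho] and [rz], so the disc of radius [sg]
   contains [K] and [(x0, y0)]. *)
pose sg := Num.max ((1 + rho) / 2) ((1 + rz) / 2).
have sg1 : sg < 1 by rewrite gt_max; apply/andP; split; lra.
have sgrho : (1 + rho) / 2 <= sg by rewrite le_max lexx.
have sgz : (1 + rz) / 2 <= sg by rewrite le_max lexx orbT.
have sg0 : 0 < sg by apply: lt_le_trans sgrho; lra.
have ann x y : sg ^+ 2 < x ^+ 2 + y ^+ 2 -> x ^+ 2 + y ^+ 2 <= 1 -> A x y <= m + e.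
  move=> h1 h2; rewrite leNgt; apply/negP => /ltW h3.
  have := cmax (x, y); rewrite inE /= => /(_ _).
  have Kxy : K (x, y) by split => //; rewrite /D /= expr1n.
  move=> /(_ Kxy); nra.
pose r := (1 + sg) / 2.
(* For such [h], translating the circle of radius [r], midway between [sg] and 1, by at most [h]
   keeps it in the annulus. *)
have main h : 0 < h -> h < (1 - sg) / 2 ->
    exists2 t, 0 <= t <= 1 & A (x0 + t * h) y0 <= m + e.
  move=> h0 hsg; have rh : r + h < 1 by rewrite /r; lra.
  have r0 : 0 <= r by rewrite /r; lra.
  have shift x y (u : R) : x ^+ 2 + y ^+ 2 <= r ^+ 2 -> `|u| <= h -> (x + u) ^+ 2 + y ^+ 2 < 1.
    move=> xy; rewrite ler_norml => /andP[u1 u2].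
    have : (r + h) ^+ 2 < 1 by nra.
    have : x <= r by nra.
    have : - r <= x by nra.
    by nra.
  have in1 x y : x ^+ 2 + y ^+ 2 <= r ^+ 2 -> x ^+ 2 + y ^+ 2 < 1.
    by move=> xy; have := @shift x y 0 xy; rewrite normr0 addr0; apply; exact: ltW.
  have inh x y : x ^+ 2 + y ^+ 2 <= r ^+ 2 -> (x + h) ^+ 2 + y ^+ 2 < 1.
    by move=> xy; apply: shift => //; rewrite gtr0_norm.
  have WE x y : x ^+ 2 + y ^+ 2 <= r ^+ 2 ->
      exists2 t, 0 <= t <= 1 & P (x + h) y - P x y = h * A (x + t * h) y.
    move=> xy; have [x1 _] := disc_in (in1 _ _ xy); have [xh1 _] := disc_in (inh _ _ xy).
    rewrite (potential_dx (in1 _ _ xy) (inh _ _ xy)).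
    have [t t01] := oint_affine 0 0 (@cA1 y) x1 xh1.
    by rewrite !mul0r !addr0 !subr0 => ->; exists t.
  have xyr : x0 ^+ 2 + y0 ^+ 2 <= r ^+ 2.
    have : (1 + sg) / 2 * ((1 + sg) / 2) >= sg by have := sqr_ge0 (1 - sg); lra.
    by rewrite -/rz /r expr2; lra.
  have [t t01 tE] := WE _ _ xyr; exists t => //.
  rewrite -(ler_pM2l h0) -tE.
  apply: (@four_point_max_principle _ (fun x y => P (x + h) y - P x y) r (2 * M)) xyr => //.
  - move=> x y x' y' xy xy'.
    have := potential_lipschitz (in1 _ _ xy') (in1 _ _ xy).
    have := potential_lipschitz (inh _ _ xy') (inh _ _ xy).
    have -> : x + h - (x' + h) = x - x' by ring.
    have -> : P (x + h) y - P x y - (P (x' + h) y' - P x' y') =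
      (P (x + h) y - P (x' + h) y') - (P x y - P x' y') by ring.
    by move=> h1 h2; apply: le_trans (ler_normB _ _) _; lra.
  - move=> x y /ltW xy eps eps0.
    have [||d1 d10 D1] := @potential_four_point x y _ (eps / 2).
    + exact: in1.
    + by rewrite divr_gt0.
    have [||d2 d20 D2] := @potential_four_point (x + h) y _ (eps / 2).
    + exact: inh.
    + by rewrite divr_gt0.
    exists (Num.min d1 d2); first by rewrite lt_min d10.
    move=> u; rewrite lt_min => /and3P[u0 ud1 ud2].
    have := D1 u; rewrite u0 ud1 => /(_ isT); rewrite ler_norml => /andP[_].
    have := D2 u; rewrite u0 ud2 => /(_ isT); rewrite ler_norml => /andP[+ _].
    have -> : x + h + u = x + u + h by ring.
    have -> : x + h - u = x - u + h by ring.
    by lra.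
  - move=> x y xyr'; have [|t' t'01 ->] := WE x y; first by rewrite xyr'.
    rewrite ler_pM2l//; apply: ann.
      have u0 : 0 <= t' * h by case/andP: t'01 => t'0 _; rewrite mulr_ge0// ltW.
      have uh : t' * h <= h by case/andP: t'01 => _ t'1; rewrite ler_piMl// ltW.
      have xr : - r <= x by nra.
      have sgr : sg < r - t' * h by rewrite /r; lra.
      have : 0 <= t' * h * (r + x) by rewrite mulr_ge0//; lra.
      have : sg ^+ 2 < (r - t' * h) ^+ 2 by rewrite ltr_pXn2r// nnegrE; lra.
      by rewrite -subr_gt0 => + h2; lra.
    apply/ltW; apply: shift; first by rewrite xyr'.
    by rewrite normrM (gtr0_norm h0) ler_piMl ?(ltW h0)// ler_norml; apply/andP; split; lra.
(* The [t] of [main] is unknown, but [t * h] tends to 0 with [h], so continuity of [A] at [x0]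
   concludes. *)
rewrite leNgt; apply/negP => gt.
have [d /= d0 dP] : \forall x \near x0, m + e < A x y0.
  by apply: (cvgr_gt _ (@cA1 y0 x0)).
pose h := Num.min (d / 2) ((1 - sg) / 4).
have h0 : 0 < h by rewrite lt_min !divr_gt0// subr_gt0.
have [|t t01] := main h h0.
  apply: (@le_lt_trans _ _ ((1 - sg) / 4)); first by rewrite ge_min lexx orbT.
  by lra.
rewrite leNgt => /negP; apply; apply: dP.
rewrite /ball /= opprD addNKr normrN normrM (gtr0_norm h0).
apply: (@le_lt_trans _ _ h).
  by rewrite ler_piMl ?(ltW h0)// ler_norml; apply/andP; split; lra.
apply: (@le_lt_trans _ _ (d / 2)); first by rewrite ge_min lexx.
by lra.
Qed.

End conj_diff_max.

(** * A real-valued norm on complex normed spaces *)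

Section real_norm.
Context {R : realType}.

Definition rnorm {V : normedModType R[i]} (x : V) : R := complex.Re `|x|.

Lemma normE_cabs (z : R[i]) : `|z| = (cabs z)%:C.
Proof. by rewrite normc_def; case: z. Qed.

Lemma cabs_sqr (z : R[i]) : cabs z ^+ 2 = complex.Re z ^+ 2 + complex.Im z ^+ 2.
Proof. by case: z => a b; rewrite /= sqr_sqrtr// addr_ge0// sqr_ge0. Qed.

Lemma Re_le_cabs (z : R[i]) : `|complex.Re z| <= cabs z.
Proof.
rewrite -ler_sqr ?nnegrE ?cabs_ge0// real_normK ?num_real// cabs_sqr.
by rewrite lerDl sqr_ge0.
Qed.

Lemma Im_le_cabs (z : R[i]) : `|complex.Im z| <= cabs z.
Proof.
rewrite -ler_sqr ?nnegrE ?cabs_ge0// real_normK ?num_real// cabs_sqr.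
by rewrite lerDr sqr_ge0.
Qed.

Lemma cabs_le_ReIm (z : R[i]) : cabs z <= `|complex.Re z| + `|complex.Im z|.
Proof.
rewrite -ler_sqr ?nnegrE ?cabs_ge0 ?addr_ge0// cabs_sqr sqrrD.
rewrite !real_normK ?num_real// -addrA lerD2l lerDr.
by rewrite mulrn_wge0// mulr_ge0.
Qed.

Context {V : normedModType R[i]}.
Implicit Types x y : V.

Lemma rnormE x : `|x| = (rnorm x)%:C.
Proof.
rewrite /rnorm; have := normr_ge0 x; case: `|x| => a b.
by rewrite lecE /= => /andP[/eqP -> _].
Qed.

Lemma rnorm_ge0 x : 0 <= rnorm x.
Proof. by rewrite -lecR -rnormE normr_ge0. Qed.

Lemma rnormD x y : rnorm (x + y) <= rnorm x + rnorm y.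
Proof. by rewrite -lecR rmorphD /= -!rnormE ler_normD. Qed.

Lemma rnormN x : rnorm (- x) = rnorm x.
Proof. by rewrite /rnorm normrN. Qed.

Lemma rnorm_dist_triangle x y (z : V) : rnorm (x - z) <= rnorm (x - y) + rnorm (y - z).
Proof. by have := rnormD (x - y) (y - z); rewrite addrA subrK. Qed.

Lemma rnorm_dist_bounds x y (e : R) : rnorm (x - y) <= e ->
  rnorm x - e <= rnorm y <= rnorm x + e.
Proof.
move=> xy; have := rnormD (x - y) y; have := rnormD (y - x) x.
rewrite !subrK -[rnorm (y - x)]rnormN opprB => h1 h2; apply/andP; split; lra.
Qed.

Lemma rnormZ (a : R[i]) x : rnorm (a *: x) = cabs a * rnorm x.
Proof. by apply: complexI; rewrite rmorphM /= -!rnormE normrZ normE_cabs. Qed.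

Lemma rnorm_eq0 x : rnorm x = 0 -> x = 0.
Proof. by move=> x0; apply/eqP; rewrite -normr_eq0 rnormE x0. Qed.

Lemma gt0_complex (e : R[i]) : 0 < e -> exists2 r : R, 0 < r & e = r%:C.
Proof. by case: e => a b; rewrite ltcE /= => /andP[/eqP -> a0]; exists a. Qed.

Lemma nbhs_rnorm x (U : set V) :
  nbhs x U <-> exists2 e : R, 0 < e & forall y, rnorm (x - y) < e -> U y.
Proof.
split.
  move=> /nbhs_normP[e /= /gt0_complex[r r0 ->] eU]; exists r => // y xy.
  by apply: eU; rewrite /= rnormE ltcR.
move=> [e e0 eU]; apply/nbhs_normP; exists e%:C; first by rewrite /= ltcR.
by move=> y /=; rewrite rnormE ltcR; exact: eU.
Qed.

End real_norm.

Lemma rnorm_cabs {R : realType} (z : R[i]^o) : rnorm z = cabs z.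
Proof. by rewrite /rnorm normE_cabs. Qed.

(** * Bounded holomorphic functions on complex lines *)

Section line.
Context {R : realType} {X : normedModType R[i]}.
Implicit Types (f : X -> R[i]^o) (x y : X).

Lemma closed_unit_ballE x : closed_unit_ball X x = (rnorm x <= 1) :> Prop.
Proof. by rewrite /closed_unit_ball /= rnormE -(lecR (rnorm x)). Qed.

Lemma unit_sphereE x : unit_sphere X x <-> rnorm x = 1.
Proof. by rewrite /unit_sphere /= rnormE; split => [/complexI//|->]. Qed.

Lemma interior_closed_unit_ball x : rnorm x < 1 -> (closed_unit_ball X)° x.
Proof.
move=> x1; apply/nbhs_rnorm; exists (1 - rnorm x); first by rewrite subr_gt0.
move=> y xy; rewrite closed_unit_ballE.
have := rnormD (y - x) x; rewrite subrK -[rnorm (y - x)]rnormN opprB.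
by lra.
Qed.

Lemma differentiable_expand f x : differentiable f x ->
  forall eps : R, 0 < eps -> exists2 d : R, 0 < d & forall h : X, rnorm h < d ->
  cabs (f (h + x) - f x - 'd f x h) <= eps * rnorm h.
Proof.
move=> /diff_locallyP[_ /eqaddoP fx] eps eps0.
have := fx eps%:C; rewrite ltcR => /(_ eps0)/nbhs_rnorm[d d0 dP].
exists d => // h hd; have := dP h; rewrite sub0r rnormN => /(_ hd) /=.
rewrite !rnormE -rmorphM /= lecR rnorm_cabs /=.
by rewrite opprD addrA.
Qed.

Definition retract (p : R * R) : R[i] :=
  let r := (Num.max 1 (Num.sqrt (p.1 ^+ 2 + p.2 ^+ 2)))^-1 in
  (p.1 * r) +i* (p.2 * r).

Lemma retract_id (p : R * R) : p.1 ^+ 2 + p.2 ^+ 2 <= 1 -> retract p = p.1 +i* p.2.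
Proof.
move=> p1; rewrite /retract max_l ?invr1 ?mulr1//.
by rewrite -[leRHS]sqrtr1 ler_wsqrtr.
Qed.

Lemma retract_le1 (p : R * R) : cabs (retract p) <= 1.
Proof.
rewrite /retract /= !exprMn -mulrDl sqrtrM ?addr_ge0 ?sqr_ge0//.
rewrite sqrtr_sqr ger0_norm ?invr_ge0 ?le_max ?ler01//.
by rewrite ler_pdivrMr ?lt_max ?ltr01// mul1r le_max lexx orbT.
Qed.

Lemma retract_continuous : continuous (retract : R * R -> R[i]^o).
Proof.
have cr : continuous (fun p : R * R => (Num.max 1 (Num.sqrt (p.1 ^+ 2 + p.2 ^+ 2)))^-1).
  move=> p; apply: cvgV.
    by rewrite gt_eqF// lt_max ltr01.
  have cm : continuous ((fun=> 1) \max (@id R)).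
    by move=> u; apply: continuous_max; [exact: cvg_cst|exact: cvg_id].
  apply: (@continuous_comp _ _ _ (fun p : R * R => Num.sqrt (p.1 ^+ 2 + p.2 ^+ 2))
    ((fun=> 1) \max (@id R))); last exact: cm.
  apply: (@continuous_comp _ _ _ (fun p : R * R => p.1 ^+ 2 + p.2 ^+ 2) Num.sqrt).
    exact: sqr_norm_continuous.
  exact: sqrt_continuous.
move=> p; apply/cvgrPdist_lt => _ /gt0_complex[e e0 ->].
have e2 : 0 < e / 2 by rewrite divr_gt0.
have c1 : continuous (fun p : R * R => complex.Re (retract p)).
  by move=> q; apply: cvgM; [exact: cvg_fst|exact: cr].
have c2 : continuous (fun p : R * R => complex.Im (retract p)).
  by move=> q; apply: cvgM; [exact: cvg_snd|exact: cr].
have /cvgrPdist_lt/(_ _ e2) n1 := c1 p; have /cvgrPdist_lt/(_ _ e2) n2 := c2 p.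
apply: filterS2 n1 n2 => q h1 h2.
rewrite normE_cabs ltcR; apply: le_lt_trans (cabs_le_ReIm _) _.
rewrite [e](_ : _ = e / 2 + e / 2); last by lra.
by apply: ltrD.
Qed.

Lemma within_ball_comp {T : topologicalType} f (phi : T -> X) :
  {within closed_unit_ball X, continuous f} -> continuous phi ->
  (forall t, closed_unit_ball X (phi t)) -> continuous (f \o phi).
Proof.
move=> /subspace_continuousP cf cphi phiB t U /(cf _ (phiB t)) fU.
have := cphi t _ fU; rewrite /nbhs /=; apply: filterS => s h; exact: h (phiB s).
Qed.

(* [A - i B] below is a unimodular multiple of [f] on the line through [y]; the
   retraction onto the disc makes it continuous on the whole plane. *)
Lemma algebra_b_line_max f y (m : R) : algebra_b X f -> unit_sphere X y ->
  (forall x, unit_sphere X x -> cabs (f x) <= m) ->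
  forall z : R[i], cabs z < 1 -> cabs (f (z *: y)) <= m.
Proof.
move=> [cf bf df] /unit_sphereE y1 fm z0 z01.
(* Rotates the value at [z0 *: y] to its modulus, so that a bound on the real part there bounds the
   modulus. *)
pose c : R[i] := if f (z0 *: y) == 0 then 1 else `|f (z0 *: y)| / f (z0 *: y).
have c1 : cabs c = 1.
  rewrite /c; case: eqP => [_|/eqP f0]; first exact: ComplexField.Normc.normc1.
  rewrite ComplexField.Normc.normcM ComplexField.Normc.normcV normE_cabs cabs_real ?cabs_ge0//.
  by rewrite divff//; apply: contra f0 => /eqP/ComplexField.Normc.eq0_normc ->.
have cf0 : c * f (z0 *: y) = (cabs (f (z0 *: y)))%:C.
  rewrite /c; case: eqP => [->|/eqP f0]; last by rewrite divfK// normE_cabs.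
  by rewrite mulr0 ComplexField.Normc.normc0.
pose A u v := complex.Re (c * f (retract (u, v) *: y)).
pose B u v := - complex.Im (c * f (retract (u, v) *: y)).
have inball (p : R * R) : closed_unit_ball X (retract p *: y).
  by rewrite closed_unit_ballE rnormZ y1 mulr1 retract_le1.
have cg : continuous (fun p : R * R => c * f (retract p *: y) : R[i]^o).
  move=> p; apply: cvgMl_tmp.
  apply: (@within_ball_comp _ f (fun p => retract p *: y) cf _ inball).
  by move=> q; apply: cvgZr_tmp; exact: retract_continuous.
have cRe : continuous (@complex.Re R : R[i]^o -> R).
  move=> z; apply/(@cvgrPdist_lt _ _ _ _ (nbhs_filter (z : R[i]^o))) => e e0; apply/nbhs_rnorm; exists e => // z'.
  by rewrite rnorm_cabs; apply: le_lt_trans; rewrite -raddfB; exact: Re_le_cabs.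
have cIm : continuous (@complex.Im R : R[i]^o -> R).
  move=> z; apply/(@cvgrPdist_lt _ _ _ _ (nbhs_filter (z : R[i]^o))) => e e0; apply/nbhs_rnorm; exists e => // z'.
  by rewrite rnorm_cabs; apply: le_lt_trans; rewrite -raddfB; exact: Im_le_cabs.
have cA : continuous (fun p : R * R => A p.1 p.2).
  have -> : (fun p : R * R => A p.1 p.2) = (fun p => complex.Re (c * f (retract p *: y))).
    by apply/funext => -[].
  move=> p; apply: (@continuous_comp _ _ _ (fun p : R * R => c * f (retract p *: y) : R[i]^o)
    (@complex.Re R : R[i]^o -> R)); last exact: cRe.
  exact: cg.
have cB u : continuous (B u).
  move=> v; apply: cvgN.
  apply: (@continuous_comp _ _ _ (fun v : R => c * f (retract (u, v) *: y) : R[i]^o)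
    (@complex.Im R : R[i]^o -> R)); last exact: cIm.
  apply: (@continuous_comp _ _ _ (fun v : R => (u, v))
    (fun p : R * R => c * f (retract p *: y) : R[i]^o)); last exact: cg.
  by apply: (@cvg_pair _ _ _ _ (nbhs u) (nbhs v)); [exact: cvg_cst|exact: cvg_id].
have [M fM] : exists M : R, forall x, closed_unit_ball X x -> cabs (f x) <= M.
  have [M [Mr MP]] := bf; exists (complex.Re M + 1) => x xB.
  have ME : M = (complex.Re M)%:C.
    by move: Mr; case: (M) => a b; rewrite realE !lecE /= => /orP[]/andP[/eqP]; [move=> ->|move=> <-].
  have := MP (M + 1); rewrite ltrDl ltr01 => /(_ isT x xB).
  rewrite /= normE_cabs ME (_ : (complex.Re M)%:C + 1 = (complex.Re M + 1)%:C) ?lecR//.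
  by rewrite rmorphD.
have bc u v : cabs (c * f (retract (u, v) *: y)) <= M.
  by rewrite ComplexField.Normc.normcM c1 mul1r fM.
have bA u v : `|A u v| <= M by apply: le_trans (Re_le_cabs _) (bc u v).
have bB u v : `|B u v| <= M.
  by rewrite normrN; apply: le_trans (Im_le_cabs _) (bc u v).
have AE u v : u ^+ 2 + v ^+ 2 <= 1 -> A u v = complex.Re (c * f ((u +i* v) *: y)).
  by move=> uv; rewrite /A retract_id.
have BE u v : u ^+ 2 + v ^+ 2 <= 1 -> B u v = - complex.Im (c * f ((u +i* v) *: y)).
  by move=> uv; rewrite /B retract_id.
have dAB u v : u ^+ 2 + v ^+ 2 < 1 -> conj_diff A B u v.
  move=> uv; set w := (u +i* v) *: y.
  have w1 : rnorm w < 1.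
    by rewrite /w rnormZ y1 mulr1 /= -sqrtr1 ltr_sqrt.
  (* Cauchy-Riemann: the real part of D (h + ik) is Re D h - Im D k, and minus its imaginary part is
     - Im D h - Re D k. *)
  pose D := c * 'd f w y.
  exists (complex.Re D), (- complex.Im D) => eps eps0.
  have [d d0 dP] := differentiable_expand (df _ (interior_closed_unit_ball w1)) eps0.
  (* The sixth keeps the displaced point in the unit disc, where [retract] is the identity. *)
  pose g := (1 - (u ^+ 2 + v ^+ 2)) / 6.
  exists (Num.min (d / 2) g).
    by rewrite lt_min !divr_gt0// subr_gt0.
  move=> h k; rewrite !lt_min => /andP[hd hg] /andP[kd kg].
  have hk1 : (u + h) ^+ 2 + (v + k) ^+ 2 <= 1.
    move: hg kg; rewrite /g !ltr_norml => /andP[? ?] /andP[? ?].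
    have u1 : u <= 1 by nra.
    have u1' : - 1 <= u by nra.
    have v1 : v <= 1 by nra.
    have v1' : - 1 <= v by nra.
    by nra.
  set de := (h +i* k) *: y.
  have hkde : rnorm de <= `|h| + `|k| by rewrite /de rnormZ y1 mulr1 (cabs_le_ReIm (h +i* k)).
  have ded : rnorm de < d by apply: le_lt_trans hkde _; lra.
  have := dP _ ded.
  have -> : de + w = ((u + h) +i* (v + k)) *: y.
    by rewrite /de /w -scalerDl; congr (_ *: _); apply/eqP; rewrite eq_complex /= ![_ + h]addrC ![_ + k]addrC !eqxx.
  have -> : 'd f w de = (h +i* k) * 'd f w y by rewrite /de linearZ.
  set z := f _ - _ - _ => zP.
  have cz : cabs (c * z) <= eps * (`|h| + `|k|).
    rewrite ComplexField.Normc.normcM c1 mul1r; apply: le_trans zP _.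
    by rewrite ler_wpM2l// ltW.
  have czE : c * z = c * f (((u + h) +i* (v + k)) *: y) - c * f w - (h +i* k) * D.
    by rewrite /z /D; ring.
  rewrite (AE _ _ hk1) (BE _ _ hk1) (AE _ _ (ltW uv)) (BE _ _ (ltW uv)) -/w.
  split.
    apply: le_trans cz; apply: le_trans (Re_le_cabs _).
    rewrite le_eqVlt; apply/orP; left; apply/eqP; congr `|_|.
    rewrite czE !raddfB /=.
    by case: (D) => a b /=; ring.
  apply: le_trans cz; apply: le_trans (Im_le_cabs _); rewrite -normrN.
  rewrite le_eqVlt; apply/orP; left; apply/eqP; congr `|_|.
  rewrite czE !raddfB /=.
  by case: (D) => a b /=; ring.
have z0E : z0 = complex.Re z0 +i* complex.Im z0 by case: (z0).
have z0in : complex.Re z0 ^+ 2 + complex.Im z0 ^+ 2 < 1.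
  by rewrite -cabs_sqr expr_lt1// cabs_ge0.
have := conj_diff_max_principle cA cB bA bB dAB (m := m).
move=> /(_ _ _ _ z0in); rewrite AE ?(ltW z0in)// -z0E cf0 /=; apply.
move=> u v uv; rewrite AE ?uv//; apply: le_trans (ler_norm _) _.
apply: le_trans (Re_le_cabs _) _; rewrite ComplexField.Normc.normcM c1 mul1r.
by apply: fm; apply/unit_sphereE; rewrite rnormZ y1 mulr1 /= uv sqrtr1.
Qed.

End line.

(** * Shilov boundaries equal to the unit sphere *)

Section shilov_criterion.
Context {R : realType} {X : normedModType R[i]}.
Implicit Types (f g : X -> R[i]^o) (x y : X).

Lemma ball_scale_sphere x : (exists y, unit_sphere X y) -> rnorm x <= 1 ->
  exists z y, [/\ unit_sphere X y, x = z *: y & cabs z = rnorm x].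
Proof.
move=> [y0 y01] x1; have [x0|x0] := eqVneq (rnorm x) 0.
  exists 0, y0; split=> //; last by rewrite x0 ComplexField.Normc.normc0.
  by rewrite scale0r; exact: rnorm_eq0.
have xp : 0 < rnorm x by rewrite lt_def x0 rnorm_ge0.
exists (rnorm x)%:C, ((rnorm x)^-1%:C *: x); split.
- by apply/unit_sphereE; rewrite rnormZ cabs_real ?invr_ge0 ?(ltW xp)// mulVf.
- by rewrite scalerA -rmorphM /= mulfV// scale1r.
- by rewrite cabs_real// ltW.
Qed.

Lemma unit_sphere_sub_ball : unit_sphere X `<=` closed_unit_ball X.
Proof. by move=> x /unit_sphereE x1; rewrite closed_unit_ballE x1. Qed.

Lemma unit_sphere_is_boundary : (exists y, unit_sphere X y) ->
  is_boundary (algebra_b X) (unit_sphere X).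
Proof.
move=> S0; split; first exact: unit_sphere_sub_ball.
move=> f fA; apply/le_anti/andP; split; last first.
  apply: ge_ereal_sup => _ [x xS <-]; apply: ereal_sup_ubound; exists x => //.
  exact: unit_sphere_sub_ball.
apply: ge_ereal_sup => _ [x xB <-]; rewrite closed_unit_ballE in xB.
set s := ereal_sup _.
have sub y : unit_sphere X y -> ((cabs (f y))%:E <= s)%E.
  by move=> yS; apply: ereal_sup_ubound; exists y.
have [z [y [yS xE zx]]] := ball_scale_sphere S0 xB.
have [x1|x1] := eqVneq (rnorm x) 1.
  by apply: sub; apply/unit_sphereE.
rewrite xE.
have := sub _ yS; case: s sub => [m||]//= sub _; last by rewrite leey.
rewrite lee_fin; apply: (algebra_b_line_max fA yS).
  by move=> u /sub; rewrite lee_fin.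
by rewrite zx lt_neqAle x1.
Qed.

Lemma closed_unit_sphere : closed (unit_sphere X).
Proof.
have -> : unit_sphere X = (fun x => `|x| : R[i]^o) @^-1` [set 1] by [].
apply: (@closed_comp X R[i]^o (fun x => `|x| : R[i]^o) [set 1]).
  by move=> x _; exact: norm_continuous.
by apply: accessible_closed_set1; apply: hausdorff_accessible; exact: norm_hausdorff.
Qed.

(** A class inside [algebra_u] that is stable under sums and products; the bound on values is what
    the product estimate uses. Both estimates are asked on the unit ball only, as quadratic
    polynomials are not globally Lipschitz. *)
Definition lipschitz_diff f := (forall x, differentiable f x) /\
  exists L : R, 0 <= L /\ (forall x, rnorm x <= 1 -> cabs (f x) <= L) /\
    (forall x y, rnorm x <= 1 -> rnorm y <= 1 -> cabs (f x - f y) <= L * rnorm (x - y)).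

Lemma lipschitz_diff_algebra_u f : lipschitz_diff f -> algebra_u X f.
Proof.
move=> [df [L [L0 [fL lip]]]].
have L1 : 0 < L + 1 by rewrite ltr_wpDl.
split; first split.
- apply: continuous_subspaceT => x; exact: differentiable_continuous.
- exists (L%:C); split; first by rewrite realE lecR L0.
  move=> M LM x; rewrite closed_unit_ballE => xB; rewrite /= normE_cabs.
  by apply: le_trans (ltW LM); rewrite lecR fL.
- by move=> x _; exact: df.
rewrite /= => U; rewrite -entourage_ballE => -[_ /= /gt0_complex[e e0 ->] eU].
exists [set xy | ball xy.1 (e / (L + 1))%:C xy.2].
  have d0 : 0 < (e / (L + 1))%:C by rewrite ltcR divr_gt0.
  exact: (entourage_ball X (PosNum d0)).
move=> [x y] /= [->|[xB [yB xy]]]; apply: eU => /=.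
  by apply: ballxx; rewrite ltcR.
rewrite !closed_unit_ballE in xB yB.
move: xy; rewrite -!ball_normE /= normE_cabs rnormE !ltcR => xy.
apply: le_lt_trans (lip _ _ xB yB) _.
apply: (@le_lt_trans _ _ ((L + 1) * rnorm (x - y))).
  by rewrite ler_wpM2r ?rnorm_ge0// lerDl.
by rewrite mulrC -ltr_pdivlMr.
Qed.

Lemma lipschitz_diff_cst (c : R[i]) : lipschitz_diff (fun=> c).
Proof.
split=> [x|]; first exact: differentiable_cst.
exists (cabs c); split; first exact: cabs_ge0.
split=> // x y _ _; rewrite subrr ComplexField.Normc.normc0.
by rewrite mulr_ge0 ?cabs_ge0 ?rnorm_ge0.
Qed.

Lemma lipschitz_diffD f g : lipschitz_diff f -> lipschitz_diff g ->
  lipschitz_diff (fun x => f x + g x).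
Proof.
move=> [df [L [L0 [fL lipf]]]] [dg [K [K0 [gK lipg]]]].
split=> [x|]; first exact: differentiableD.
exists (L + K); split; first exact: addr_ge0.
split=> [x xB|x y xB yB].
  by apply: le_trans (le_normcD _ _) _; apply: lerD; [exact: fL|exact: gK].
rewrite opprD addrACA mulrDl; apply: le_trans (le_normcD _ _) _.
by apply: lerD; [exact: lipf|exact: lipg].
Qed.

Lemma lipschitz_diffM f g : lipschitz_diff f -> lipschitz_diff g ->
  lipschitz_diff (fun x => f x * g x).
Proof.
move=> [df [L [L0 [fL lipf]]]] [dg [K [K0 [gK lipg]]]].
split=> [x|]; first exact: differentiableM.
exists (L * K + L * K); split; first by rewrite addr_ge0// mulr_ge0.
split=> [x xB|x y xB yB].
  rewrite ComplexField.Normc.normcM; apply: (@le_trans _ _ (L * K)).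
    by apply: ler_pM; rewrite ?cabs_ge0 ?fL ?gK.
  by rewrite lerDl mulr_ge0.
have -> : f x * g x - f y * g y = f x * (g x - g y) + (f x - f y) * g y.
  by ring.
apply: le_trans (le_normcD _ _) _; rewrite !ComplexField.Normc.normcM mulrDl.
apply: lerD; first by rewrite -mulrA; apply: ler_pM; rewrite ?cabs_ge0 ?fL ?lipg.
rewrite mulrAC; apply: ler_pM; rewrite ?cabs_ge0 ?gK//.
exact: lipf.
Qed.

Lemma lipschitz_diff_sum (I : eqType) (r : seq I) (F : I -> X -> R[i]^o) :
  (forall i, i \in r -> lipschitz_diff (F i)) ->
  lipschitz_diff (fun x => \sum_(i <- r) F i x).
Proof.
elim: r => [|i r IH] h.
  by under eq_fun do rewrite big_nil; exact: lipschitz_diff_cst.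
under eq_fun do rewrite big_cons; apply: lipschitz_diffD.
  by apply: h; rewrite mem_head.
by apply: IH => j jr; apply: h; rewrite in_cons jr orbT.
Qed.

Lemma lipschitz_diff_linear (f : {linear X -> R[i]^o}) (C : R) :
  (forall x, rnorm x <= 1 -> cabs (f x) <= C) -> lipschitz_diff f.
Proof.
move=> fC.
have C0 : 0 <= C.
  apply: le_trans (fC 0 _); first exact: cabs_ge0.
  by rewrite /rnorm normr0 ler01.
have bd x : cabs (f x) <= C * rnorm x.
  have [x0|x0] := eqVneq (rnorm x) 0.
    by rewrite (rnorm_eq0 x0) linear0 ComplexField.Normc.normc0 mulr_ge0 ?rnorm_ge0.
  have xp : 0 < rnorm x by rewrite lt_def x0 rnorm_ge0.
  have := fC ((rnorm x)^-1%:C *: x).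
  rewrite rnormZ cabs_real ?invr_ge0 ?(ltW xp)// mulVf// => /(_ (lexx _)).
  rewrite linearZ /= ComplexField.Normc.normcM cabs_real ?invr_ge0 ?(ltW xp)//.
  by rewrite mulrC ler_pdivrMr.
split.
  move=> x; apply: linear_differentiable => {}x.
  apply/(@cvgrPdist_lt _ _ _ _ (nbhs_filter x)) => _ /gt0_complex[e e0 ->].
  have C1 : 0 < C + 1 by rewrite ltr_wpDl.
  apply/nbhs_rnorm; exists (e / (C + 1)); first by rewrite divr_gt0.
  move=> y xy; rewrite -linearB normE_cabs ltcR; apply: le_lt_trans (bd _) _.
  apply: (@le_lt_trans _ _ ((C + 1) * rnorm (x - y))).
    by rewrite ler_wpM2r ?rnorm_ge0// lerDl.
  by rewrite mulrC -ltr_pdivlMr.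
exists C; split=> //; split=> // x y _ _.
by rewrite -linearB.
Qed.

(** On a boundary avoiding the [e]-ball around [a], the modulus of [f] would be at most [q], which
    is below its value at [a]. *)
Lemma peak_meets_boundary (F : set X) f a (e q : R) :
  is_boundary (algebra_u X) F -> lipschitz_diff f -> rnorm a <= 1 ->
  q < cabs (f a) ->
  (forall x, rnorm x <= 1 -> e <= rnorm (x - a) -> cabs (f x) <= q) ->
  exists2 x, F x & rnorm (x - a) < e.
Proof.
move=> [FB Fsup] /lipschitz_diff_algebra_u fA a1 qa far.
apply: contrapT => h; have := Fsup f fA.
apply/eqP; rewrite gt_eqF//.
apply: (@le_lt_trans _ _ q%:E).
  apply: ge_ereal_sup => _ [x Fx <-]; rewrite lee_fin; apply: far.
    by rewrite -closed_unit_ballE; exact: FB.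
  by rewrite leNgt; apply/negP => xa; apply: h; exists x.
apply: (@lt_le_trans _ _ (cabs (f a))%:E); first by rewrite lte_fin.
by apply: ereal_sup_ubound; exists a => //; rewrite closed_unit_ballE.
Qed.

(** Since [algebra_u] is contained in [algebra_b], a boundary for the larger algebra is one for the
    smaller. Hence minimality is needed for [algebra_u] only, and the boundary property for
    [algebra_b] only. *)
Lemma shilov_unit_sphere : (exists y, unit_sphere X y) ->
  (forall F, closed F -> is_boundary (algebra_u X) F -> unit_sphere X `<=` F) ->
  [/\ shilov_exists (algebra_u X), shilov_exists (algebra_b X),
      shilov (algebra_u X) = shilov (algebra_b X)
    & shilov (algebra_b X) = unit_sphere X].
Proof.
move=> S0 SF; have Sb := unit_sphere_is_boundary S0.
have b_u F : is_boundary (algebra_b X) F -> is_boundary (algebra_u X) F.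
  by move=> [FB Fb]; split=> // f [fb _]; exact: Fb.
have ub : shilov (algebra_u X) = unit_sphere X.
  apply/seteqP; split=> [x|x Sx F [cF FA]]; last exact: SF.
  by apply; split; [exact: closed_unit_sphere|exact: b_u].
have bb : shilov (algebra_b X) = unit_sphere X.
  apply/seteqP; split=> [x|x Sx F [cF FA]]; last by apply: SF => //; exact: b_u.
  by apply; split; [exact: closed_unit_sphere|].
by rewrite /shilov_exists ub bb; split=> //; exact: b_u.
Qed.

End shilov_criterion.

(** * Orlicz-Lorentz modulars *)

Section injections.
Implicit Types (sg ta : nat -> nat).

Lemma le_sum_ord (F : nat -> nat) N n : (n < N)%N -> (F n <= \sum_(i < N) F i)%N.
Proof. by move=> nN; rewrite (bigD1 (Ordinal nN))//= leq_addr. Qed.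

Lemma extend_injective N sg : {in `I_N &, injective sg} ->
  exists2 sg', injective sg' & forall n, (n < N)%N -> sg' n = sg n.
Proof.
move=> inj; pose B := (\sum_(i < N) sg i)%N.
exists (fun n => if (n < N)%N then sg n else (n + B.+1)%N); last by move=> n ->.
move=> i j; case: (ltnP i N) => iN; case: (ltnP j N) => jN.
- by apply: inj; rewrite inE.
- by move=> h; have := le_sum_ord sg iN; rewrite -/B; lia.
- by move=> h; have := le_sum_ord sg jN; rewrite -/B; lia.
- by lia.
Qed.

(** Serves to remove a finite set of coordinates from a sum: indices landing in [s] are moved beyond
    [s] and beyond all values [ta i] with [i < N]; the others stay put. *)
Lemma avoid_injective (s : seq nat) ta N : injective ta ->
  exists2 ta', {in `I_N &, injective ta'} &
    forall j, (j < N)%N -> ta' j \notin s /\ (ta j \notin s -> ta' j = ta j).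
Proof.
move=> inj; pose B := (\sum_(i < N) ta i + sumn s)%N.
have sB k : k \in s -> (k <= sumn s)%N.
  elim: s {B} => //= a s IH; rewrite in_cons => /orP[/eqP ->|/IH h]; first exact: leq_addr.
  by apply: leq_trans h _; exact: leq_addl.
exists (fun j => if ta j \in s then (B.+1 + ta j)%N else ta j).
  move=> i j; rewrite !inE /= => iN jN.
  have := le_sum_ord ta iN; have := le_sum_ord ta jN => ti tj.
  case: ifP => is'; case: ifP => js h; apply: inj; rewrite /B in h; lia.
move=> j jN; case: ifP => js; last by rewrite js.
split=> //; apply/negP => /sB; rewrite /B; lia.
Qed.

End injections.

(** * The modular as a supremum over injections *)

Section modular_sums.
Context {R : realType} (phi : orlicz_function R) (w : weight_sequence R).
Implicit Types (x y z : nat -> R[i]) (sg ta : nat -> nat).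
Local Open Scope ereal_scope.

Lemma weighted_orlicz_ge0 (r : R) n : 0 <= phi r * (w n)%:E.
Proof. by rewrite mule_ge0 ?orlicz_ge0// lee_fin ltW// weight_gt0. Qed.

Lemma sum_le_modular x sg N : {in `I_N &, injective sg} ->
  \sum_(n < N) phi (cabs (x (sg n))) * (w n)%:E <= modular phi w x.
Proof.
by move=> inj; apply: le_trans (sum_le_rearrangement _ _ _ inj) (modular_ge _ _ _ _).
Qed.

(** With [sum_le_modular], the modular becomes the supremum of finite sums over injections. Each
    rearranged value is approached from below by levels [s n j]; more than [n] coordinates reach
    this level, so distinct representatives can be picked greedily. *)
Lemma modular_le_sums x B :
  (forall N sg, injective sg ->
    \sum_(n < N) phi (cabs (x (sg n))) * (w n)%:E <= B) ->
  modular phi w x <= B.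
Proof.
move=> xB; apply: modular_le => N.
have /choice[s sP] n := orlicz_approx phi (rearrangement_ge0 x n).
have cv : (\sum_(n < N) phi (s n j) * (w n)%:E)%E @[j --> \oo] -->
    (\sum_(n < N) orlicz_ext phi (rearrangement x n) * (w n)%:E)%E.
  apply: cvg_nnesum => n _.
    by apply: nearW => j; exact: weighted_orlicz_ge0.
  by apply: cvgeZr => //; exact: (sP n).2.
rewrite -(cvg_lim _ cv)//; apply: lime_le; first by apply/cvg_ex; eexists; exact: cv.
apply: nearW => j.
have s0 n : (0 <= s n j)%R by case: ((sP n).1 j) => [->|[]].
have [sg inj sgP] : exists2 sg : nat -> nat, {in `I_N &, injective sg} &
    forall n, (n < N)%N -> (s n j <= cabs (x (sg n)))%R.
  have [n nN|sg inj sgP] := @select (fun n => [set k | s n j <= cabs (x k)]%R) N.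
    case: ((sP n).1 j) => [s00|[_ sz]].
      rewrite s00 (_ : [set _ | _] = setT); last first.
        by apply/seteqP; split => // k _ /=; exact: cabs_ge0.
      move=> h; have : (`I_n.+1 #<= `I_n)%card.
        by apply: card_le_trans h; exact: subset_card_le.
      by rewrite card_le_II ltnn.
    move=> h; apply: (lt_rearrangement (s0 n) sz); apply: card_le_trans h.
    by apply: subset_card_le => k /= /ltW.
  by exists sg.
have [sg' inj' sgE] := extend_injective inj.
apply: le_trans (xB N sg' inj'); apply: lee_sum => n _.
apply: lee_wpmul2r; first by rewrite lee_fin ltW// weight_gt0.
by apply: orlicz_mono => //; rewrite sgE// sgP.
Qed.

Lemma sum_cat_le_modular x sg ta m N :
  {in `I_m &, injective sg} -> {in `I_N &, injective ta} ->
  (forall i j, (i < m)%N -> (j < N)%N -> sg i <> ta j) ->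
  \sum_(i < m) phi (cabs (x (sg i))) * (w i)%:E +
  \sum_(j < N) phi (cabs (x (ta j))) * (w (m + j)%N)%:E <= modular phi w x.
Proof.
move=> injs injt disj.
pose f n := if (n < m)%N then sg n else ta (n - m)%N.
have injf : {in `I_(m + N) &, injective f}.
  move=> i j; rewrite !inE /= /f => iN jN.
  case: (ltnP i m) => im; case: (ltnP j m) => jm.
  - by apply: injs; rewrite inE.
  - by move=> /disj h; exfalso; apply: h => //; lia.
  - by move=> /esym/disj h; exfalso; apply: h => //; lia.
  - by move=> h; suff : (i - m = j - m)%N by [lia]; apply: injt h; rewrite inE /=; lia.
apply: le_trans (sum_le_modular _ injf); rewrite big_split_ord /=; apply: leeD.
  by apply: lee_sum => i _; rewrite /f /= ltn_ord.
by apply: lee_sum => j _; rewrite /f /= ltnNge leq_addr /= addKn.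
Qed.

Lemma orlicz_small (e : R) : (0 < e)%R ->
  exists2 r : R, (0 < r)%R & forall u, (`|u| <= r)%R -> phi u <= e%:E.
Proof.
move=> e0.
have [d /= d0 dP] : nbhs (0%R : R) [set u | phi u < e%:E].
  have h : nbhs (phi 0%R) [set y | y < e%:E].
    by apply: open_nbhs_nbhs; split; [exact: open_ereal_lt_ereal|rewrite /= orlicz0 lte_fin].
  exact: (@orlicz_continuous _ phi 0%R _ h).
exists (d / 2)%R; first by rewrite divr_gt0.
move=> u ud; apply/ltW/dP; rewrite /ball /= sub0r normrN.
by apply: le_lt_trans ud _; lra.
Qed.

(** Undoes the shift of weights caused by listing [m] coordinates first. The terms of index at least
    [m] form a shifted sum; each of the first [m] is at most [w 0 / w m] times a one-term shifted
    sum. *)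
Lemma shifted_sums_le_modular x m (d : R) :
  (forall N sg, injective sg ->
    \sum_(j < N) phi (cabs (x (sg j))) * (w (m + j)%N)%:E <= d%:E) ->
  modular phi w x <= (d * (1 + m%:R * (w 0%N / w m)))%:E.
Proof.
move=> xd; apply: modular_le_sums => N sg inj.
have w0m : (0 <= w 0%N / w m)%R by rewrite divr_ge0// ltW// weight_gt0.
have wm := weight_gt0 w m.
apply: (@le_trans _ _ (\sum_(n < m + N) phi (cabs (x (sg n))) * (w n)%:E)).
  rewrite [leRHS](_ : _ = \sum_(n < N + m) phi (cabs (x (sg n))) * (w n)%:E); last by rewrite addnC.
  rewrite big_split_ord /= leeDl// sume_ge0// => i _.
  exact: weighted_orlicz_ge0.
rewrite (_ : _ * _ = m%:R * (d * (w 0%N / w m)) + d)%R; last by ring.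
rewrite big_split_ord /= EFinD; apply: leeD; last first.
  by apply: (xd N (fun j => sg (m + j)%N)) => i j /inj; lia.
have term n : (n < m)%N -> phi (cabs (x (sg n))) * (w n)%:E <= (d * (w 0%N / w m))%:E.
  move=> nm; have := xd 1%N (fun j => sg (n + j)%N); rewrite big_ord1 !addn0.
  have injn : injective (fun j => sg (n + j)%N) by move=> i j /inj; lia.
  move=> /(_ injn) h.
  apply: (@le_trans _ _ (phi (cabs (x (sg n))) * (w 0%N)%:E)).
    by apply: lee_wpmul2l; rewrite ?orlicz_ge0// lee_fin weight_nonincreasing.
  rewrite EFinM.
  have -> : (w 0%N)%:E = (w m)%:E * (w 0%N / w m)%:E.
    by rewrite -EFinM mulrC divfK// gt_eqF.
  by rewrite muleA; apply: lee_wpmul2r => //; rewrite lee_fin.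
apply: (@le_trans _ _ (\sum_(n < m) (d * (w 0%N / w m))%:E)).
  by apply: lee_sum => n _; exact: term.
by rewrite sumEFin sumr_const card_ord lee_fin mulr_natl.
Qed.

Lemma orlicz_pos_lb (r : R) : (0 < r)%R -> exists2 p : R, (0 < p)%R & p%:E <= phi r.
Proof.
move=> r0; have : 0 < phi r.
  by rewrite lt0e orlicz_ge0 andbT; apply/eqP => /orlicz_eq0 h; rewrite h ltxx in r0.
case: (phi r) => [q||]//; first by rewrite lte_fin => q0; exists q.
by move=> _; exists 1%R => //; rewrite leey.
Qed.

(** With infinitely many coordinates above [r], the modular would dominate a positive multiple of
    the sum of the weights: this is where their divergence enters. *)
Lemma coordinate_vanishes x (M r : R) : modular phi w x <= M%:E -> (0 < r)%R ->
  exists n, forall k, (n <= k)%N -> (cabs (x k) <= r)%R.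
Proof.
move=> xM r0; pose E := [set k | r < cabs (x k)]%R.
have [p p0 pr] := orlicz_pos_lb r0.
have [N EN] : exists N, (E #<= `I_N)%card.
  apply: contrapT => h.
  have bound N : \sum_(0 <= n < N) (w n)%:E <= (M / p)%:E.
    have [n _|sg inj sgE] := @select (fun=> E) N; first by move=> EN; apply: h; exists n.
    have : \sum_(n < N) p%:E * (w n)%:E <= M%:E.
      apply: le_trans xM; apply: le_trans (sum_le_modular x inj); apply: lee_sum => n _.
      apply: lee_wpmul2r; first by rewrite lee_fin ltW// weight_gt0.
      apply: le_trans pr _; apply: orlicz_mono; first exact: ltW.
      exact/ltW/sgE.
    under eq_bigr do rewrite -EFinM.
    by rewrite big_mkord !sumEFin !lee_fin -mulr_sumr ler_pdivlMr// mulrC.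
  have : \sum_(0 <= n <oo) (w n)%:E <= (M / p)%:E.
    apply: lime_le; last exact: nearW.
    by apply: is_cvg_nneseries => n _ _; rewrite lee_fin ltW// weight_gt0.
  by rewrite weight_sum leye_eq.
have /finite_seqP[s sE] : finite_set E by apply: card_le_finite EN _; exact: finite_II.
exists (sumn s).+1 => k ks; rewrite leNgt; apply/negP => kE.
have : k \in s by have : E k by []; rewrite sE.
move=> {kE sE}; elim: s ks => //= a s IH ks; rewrite in_cons => /orP[/eqP h|/IH]; first by lia.
by apply; lia.
Qed.

End modular_sums.

(** * Luxemburg norm against modular *)

Section luxemburg.
Context {R : realType} (phi : orlicz_function R) (w : weight_sequence R).
Implicit Types (x y z : nat -> R[i]) (sg ta : nat -> nat).
Local Open Scope ereal_scope.

Lemma scaled_sum_cvg x sg N (t : nat -> R) : t j @[j --> \oo] --> (1 : R)%R ->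
  (\sum_(n < N) phi (t j * cabs (x (sg n)))%R * (w n)%:E)%E @[j --> \oo] -->
  (\sum_(n < N) phi (cabs (x (sg n))) * (w n)%:E)%E.
Proof.
move=> t1; apply: cvg_nnesum => n _.
  by apply: nearW => j; exact: weighted_orlicz_ge0.
have tx : (t j * cabs (x (sg n)))%R @[j --> \oo] --> cabs (x (sg n)).
  by rewrite -[X in _ --> X]mul1r; exact: cvgMr_tmp.
by apply: cvgeZr => //; exact: cvg_comp tx (@orlicz_continuous _ phi _).
Qed.

Lemma luxemburg_norm_le x (l : R) : (0 < l)%R ->
  modular phi w ((l^-1)%:C *: x) <= 1 -> (luxemburg_norm phi w x <= l)%R.
Proof. by move=> l0 xl; apply: ge_inf; [exact: lux_lb|]. Qed.

(** The infimum defining the norm gives the bound at [t%:C *: x] for [t < 1]; finite sums depend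
    continuously on [t], so it persists at [t = 1]. *)
Lemma modular_le1 x : orlicz_lorentz_set phi w x ->
  (luxemburg_norm phi w x <= 1)%R -> modular phi w x <= 1.
Proof.
move=> xX x1.
have small (t : R) : (0 <= t)%R -> (t < 1)%R -> modular phi w (t%:C *: x) <= 1.
  (* This margin gives [l < 2 / (1 + t)], hence [t * l <= 1]. *)
  move=> t0 t1; have e0 : (0 < (1 + t)^-1 * (1 - t) )%R by rewrite mulr_gt0 ?invr_gt0; lra.
  have [l [l0 ml] ll] := inf_adherent e0 (conj (lux_nonempty xX) (lux_lb phi w x)).
  apply: le_trans ml; apply: modular_mono => k.
  rewrite !cabsZr ?invr_ge0 ?(ltW l0)//; apply: ler_wpM2r; first exact: cabs_ge0.
  rewrite -[leRHS]mul1r ler_pdivlMr//.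
  have {ll} : (l < 1 + (1 + t)^-1 * (1 - t))%R.
    by apply: lt_le_trans ll _; rewrite lerD2r.
  have -> : (1 + (1 + t)^-1 * (1 - t) = 2 / (1 + t))%R by field; apply/negP => /eqP; lra.
  rewrite ltr_pdivlMr; last by lra.
  by move=> h; nra.
apply: modular_le_sums => N sg inj.
have t1 : (1 - harmonic j : R)%R @[j --> \oo] --> (1 : R)%R.
  by rewrite -[X in _ --> X]subr0; apply: cvgB; [exact: cvg_cst|exact: cvg_harmonic].
have cv := @scaled_sum_cvg x sg N _ t1.
rewrite -(cvg_lim _ cv)//; apply: lime_le; first by apply/cvg_ex; eexists; exact: cv.
apply: nearW => j.
have h1 : (0 < (harmonic j : R) <= 1)%R.
  by rewrite /harmonic /= invr_gt0 ltr0n /= invf_le1 ?ltr0n// ler1n.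
apply: le_trans (small (1 - harmonic j)%R _ _); [|lra|lra].
apply: le_trans (sum_le_modular phi w _ (sg := sg) (N := N) _); last by move=> ? ? _ _; exact: inj.
apply: lee_sum => n _; rewrite cabsZr//; lra.
Qed.

Lemma orlicz_ext_le (a : \bar R) (r : R) : 0 <= a -> a <= r%:E ->
  orlicz_ext phi a <= phi r.
Proof. by case: a => [s||]//=; rewrite !lee_fin; exact: orlicz_mono. Qed.

Lemma rearrangement_le x (s : seq nat) n (r : R) : (0 <= r)%R ->
  (forall k, (r < cabs (x k))%R -> k \in s /\ (index k s < n)%N) ->
  rearrangement x n <= r%:E.
Proof.
move=> r0 xs; apply: ereal_inf_lbound; exists r => //; split=> //.
apply: (card_le_trans _ (card_image_le (nth 0%N s) `I_n)).
by apply: subset_card_le => k /xs[ks kn]; exists (index k s) => //; exact: nth_index.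
Qed.

(* The rearrangement of a finitely supported sequence is realised by sorting its support. *)
Lemma sorted_support x n : (forall k, (n <= k)%N -> x k = 0%R) ->
  exists s : seq nat, [/\ uniq s, forall k, (k \in s) = (x k != 0%R) &
    forall t : R, (0 <= t)%R -> modular phi w (t%:C *: x) <=
      \sum_(i < size s) phi (t * cabs (x (nth 0%N s i)))%R * (w i)%:E].
Proof.
move=> x0; pose r := [rel i j | (cabs (x j) <= cabs (x i))%R].
pose s := sort r [seq k <- iota 0 n | x k != 0%R].
have tot : total r by move=> i j; rewrite /r /=; exact: le_total.
have trr : transitive r by move=> j i k /= h1 h2; exact: le_trans h2 h1.
have ss : sorted r s := sort_sorted tot _.
have mems k : (k \in s) = (x k != 0%R).
  rewrite mem_sort mem_filter mem_iota /= add0n.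
  by case: (ltnP k n) => kn; rewrite ?andbT// x0// eqxx.
exists s; split=> //; first by rewrite sort_uniq filter_uniq// iota_uniq.
move=> t t0; apply: modular_le => N.
(* Inside the support at most [i] coordinates exceed the [i]-th sorted value, counted from 0; beyond
   it the rearrangement is 0. *)
pose F n := if (n < size s)%N then phi (t * cabs (x (nth 0%N s n)))%R * (w n)%:E else 0.
have F0 i : 0 <= F i.
  by rewrite /F; case: ifP => // _; exact: weighted_orlicz_ge0.
have le1 i : orlicz_ext phi (rearrangement (t%:C *: x) i) * (w i)%:E <= F i.
  rewrite /F; case: (ltnP i (size s)) => si.
    apply: lee_wpmul2r; first by rewrite lee_fin ltW// weight_gt0.
    apply: orlicz_ext_le; first exact: rearrangement_ge0.
    apply: (rearrangement_le (s := s)); first by rewrite mulr_ge0 ?cabs_ge0.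
    move=> k; rewrite cabsZr// => lt.
    have ks : k \in s.
      rewrite mems; apply: contraTneq lt => ->.
      by rewrite ComplexField.Normc.normc0 mulr0 -leNgt mulr_ge0// cabs_ge0.
    split=> //; rewrite ltnNge; apply/negP => ik.
    move: lt; rewrite ltNge => /negP; apply; apply: ler_wpM2l => //.
    have rr : reflexive r by move=> u; exact: lexx.
    have := sorted_leq_nth trr rr 0%N ss i (index k s).
    by rewrite !inE nth_index// index_mem; apply.
  rewrite (_ : rearrangement _ _ = 0) ?/= ?orlicz0 ?mul0e//.
  apply/le_anti; rewrite rearrangement_ge0 andbT.
  apply: (rearrangement_le (s := s)) => // k; rewrite cabsZr// => lt.
  have ks : k \in s.
    by rewrite mems; apply: contraTneq lt => ->; rewrite ComplexField.Normc.normc0 mulr0 ltxx.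
  by split=> //; apply: leq_trans si; rewrite index_mem.
apply: (@le_trans _ _ (\sum_(n < N) F n)); first by apply: lee_sum => i _; exact: le1.
apply: (@le_trans _ _ (\sum_(n < N + size s) F n)).
  by rewrite big_split_ord /= leeDl// sume_ge0.
rewrite addnC big_split_ord /= [X in _ + X]big1 ?adde0.
  by apply: lee_sum => i _; rewrite /F ltn_ord.
by move=> i _; rewrite /F ltnNge leq_addr.
Qed.
End luxemburg.

Section orlicz.
Context {R : realType} (phi : orlicz_function R) (w : weight_sequence R).
Implicit Types (x : nat -> R[i]).
Local Open Scope ereal_scope.

(** A finite sum of continuous terms below 1 stays below 1 under some dilation by [1 + harmonic j],
    which would force the norm below 1. *)
Lemma unit_support_sum x (s : seq nat) :
  (forall t : R, (0 <= t)%R -> modular phi w (t%:C *: x) <=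
      \sum_(i < size s) phi (t * cabs (x (nth 0%N s i)))%R * (w i)%:E) ->
  (1 <= luxemburg_norm phi w x)%R ->
  1 <= \sum_(i < size s) phi (cabs (x (nth 0%N s i))) * (w i)%:E.
Proof.
move=> xs x1; rewrite leNgt; apply/negP => lt1.
have t1 : (1 + harmonic j : R)%R @[j --> \oo] --> (1 : R)%R.
  by rewrite -[X in _ --> X]addr0; apply: cvgD; [exact: cvg_cst|exact: cvg_harmonic].
have cv := @scaled_sum_cvg _ phi w x (nth 0%N s) (size s) _ t1.
have op : nbhs (\sum_(n < size s) phi (cabs (x (nth 0%N s n))) * (w n)%:E)%E [set y | y < 1].
  by apply: open_nbhs_nbhs; split; [exact: open_ereal_lt_ereal|].
have /filter_ex[j /= jP] : \forall j \near \oo,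
    \sum_(n < size s) phi ((1 + harmonic j) * cabs (x (nth 0%N s n)))%R * (w n)%:E < 1.
  exact: (cv _ op).
have h1 : (0 < (harmonic j : R))%R by rewrite /harmonic /= invr_gt0 ltr0n.
have t0 : (0 < 1 + (harmonic j : R))%R by rewrite addr_gt0.
have := @luxemburg_norm_le _ phi w x (1 + harmonic j)^-1.
rewrite invr_gt0 invrK => /(_ t0 (le_trans (xs _ (ltW t0)) (ltW jP))).
move=> /(le_trans x1); rewrite leNgt => /negP; apply.
by rewrite invf_lt1// ltrDl.
Qed.

(** The slope is the supremum of the left difference quotients. It is positive since the quotient
    from 0 is [phi u / u], and finite since any quotient to the right bounds it; continuity provides
    a point beyond [u] where [phi] is finite. *)
Lemma subgradient (u : R) : (0 < u)%R -> phi u < +oo ->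
  exists2 p : R, (0 < p)%R & forall v, (0 <= v)%R ->
    (fine (phi u) + p * (v - u))%:E <= phi v.
Proof.
move=> u0 uoo; pose f v := fine (phi v).
have fE v : phi v < +oo -> phi v = (f v)%:E.
  by move=> voo; rewrite fineK// ge0_fin_numE// orlicz_ge0.
have fu0 : (0 < f u)%R.
  by have [p p0] := orlicz_pos_lb phi u0; rewrite fE// lee_fin; apply: lt_le_trans.
have [v0 uv0 v0oo] : exists2 v0, (u < v0)%R & phi v0 < +oo.
  have op : nbhs (phi u) [set y | y < +oo].
    by apply: open_nbhs_nbhs; split; [exact: open_ereal_lt_ereal|].
  have [d /= d0 dP] := @orlicz_continuous _ phi u _ op.
  exists (u + d / 2)%R; first by rewrite ltrDl divr_gt0.
  apply: dP; rewrite /ball /= opprD addNKr normrN gtr0_norm ?divr_gt0//; lra.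
have slope v' v : (0 <= v')%R -> (v' < u)%R -> (u < v)%R -> phi v < +oo ->
    (f u * (v - v') <= (v - u) * f v' + (u - v') * f v)%R.
  move=> v'0 v'u uv voo; have vv : (0 < v - v')%R by lra.
  pose t := ((v - u) / (v - v'))%R.
  have t1 : (1 - t = (u - v') / (v - v'))%R by rewrite /t; field; rewrite gt_eqF.
  have t01 : (0 <= t <= 1)%R by rewrite /t divr_ge0 ?ler_pdivrMr//=; lra.
  have := orlicz_convex phi v' v t01.
  have -> : (t * v' + (1 - t) * v = u)%R by rewrite t1 /t; field; rewrite gt_eqF.
  have v'oo : phi v' < +oo by apply: le_lt_trans uoo; apply: orlicz_mono => //; exact: ltW.
  rewrite (fE _ uoo) (fE _ v'oo) (fE _ voo) -!EFinM -EFinD lee_fin t1 /t => h.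
  rewrite -ler_pdivlMr//; apply: le_trans h _.
  by rewrite le_eqVlt; apply/orP; left; apply/eqP; field; rewrite gt_eqF.
pose A := [set ((f u - f v) / (u - v))%R | v in [set v | (0 <= v < u)%R]].
have ub v : (u < v)%R -> phi v < +oo -> ubound A ((f v - f u) / (v - u))%R.
  move=> uv voo _ [v' /= /andP[v'0 v'u] <-].
  rewrite ler_pdivrMr ?subr_gt0// mulrAC ler_pdivlMr ?subr_gt0//.
  by have := slope v' v v'0 v'u uv voo; lra.
have A0 : A (f u / u)%R.
  by exists 0%R; rewrite /= ?lexx ?u0// /f orlicz0 /= !subr0.
have hs : has_sup A by split; [exists (f u / u)%R | exists ((f v0 - f u) / (v0 - u))%R; exact: ub].
exists (sup A).
  by apply: lt_le_trans (sup_upper_bound hs A0); rewrite divr_gt0.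
move=> v v_ge0; rewrite -/(f u).
have [vu|uv|->] := ltgtP v u.
- have voo : phi v < +oo by apply: le_lt_trans uoo; apply: orlicz_mono => //; exact: ltW.
  rewrite (fE v)// lee_fin.
  have Av : A ((f u - f v) / (u - v))%R by exists v => //=; rewrite v_ge0.
  have := sup_upper_bound hs Av; rewrite ler_pdivrMr ?subr_gt0//; lra.
- have [voo|] := ltP (phi v) +oo; last by rewrite leye_eq => /eqP ->; rewrite leey.
  rewrite (fE v)// lee_fin.
  have := ge_sup hs.1 (ub v uv voo); rewrite ler_pdivlMr ?subr_gt0//; lra.
- by rewrite subrr mulr0 addr0 fE.
Qed.

(** By convexity [phi u >= u * phi 1] for [u >= 1], while [phi (cabs (x k)) * w 0 <= 1]. *)
Lemma coordinate_bound : exists2 C : R, (0 < C)%R &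
  forall x, modular phi w x <= 1 -> forall k, (cabs (x k) <= C)%R.
Proof.
have [p p0 p1] := orlicz_pos_lb phi (@ltr01 R).
have w0 := weight_gt0 w 0.
exists (Num.max 1 (p * w 0%N)^-1)%R; first by rewrite lt_max ltr01.
move=> x x1 k; rewrite le_max; have [//|x_gt1] := leP (cabs (x k)) 1%R => /=.
set u := cabs (x k) in x_gt1 *; have u0 : (0 < u)%R by lra.
have := le_trans (orlicz_le_modular phi w x k) x1; rewrite -/u => h.
have : (u * p)%:E <= phi u.
  have u1 : (0 <= u^-1 <= 1)%R by rewrite invr_ge0 (ltW u0) invf_le1// ltW.
  have := orlicz_scale phi u u1; rewrite mulVf ?gt_eqF// => /(le_trans p1) pu.
  have := lee_wpmul2l (x := u%:E) _ pu; rewrite lee_fin (ltW u0) => /(_ isT).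
  by rewrite muleA -!EFinM divff ?gt_eqF// mul1e.
move=> /(lee_wpmul2r (x := (w 0%N)%:E)); rewrite lee_fin (ltW w0) => /(_ isT).
move=> /le_trans/(_ h); rewrite -EFinM lee_fin -mulrA => upw.
by rewrite -[leRHS]mul1r ler_pdivlMr// mulr_gt0.
Qed.

Lemma delta2_iter : delta2 phi -> forall M, exists K r : R, [/\ (0 < K)%R, (0 < r)%R &
  forall v, (0 <= v <= r)%R -> phi (2 ^+ M * v)%R <= K%:E * phi v].
Proof.
move=> [K [u0 [K0 u00 _ KP]]]; elim=> [|M [K' [r [K'0 r0 rP]]]].
  by exists 1%R, 1%R; split=> // v _; rewrite expr0 mul1r mul1e.
have p2 : (0 < 2 ^+ M :> R)%R by rewrite exprn_gt0.
exists (K * K')%R, (Num.min r (u0 / 2 ^+ M))%R; split; first exact: mulr_gt0.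
  by rewrite lt_min r0 divr_gt0.
move=> v; rewrite le_min => /and3P[v0 vr vu].
rewrite exprS -mulrA; apply: le_trans (KP _ _) _.
  by rewrite mulr_ge0 ?(ltW p2)//= mulrC -ler_pdivlMr.
rewrite EFinM -muleA; apply: lee_wpmul2l; first by rewrite lee_fin ltW.
by apply: rP; rewrite v0.
Qed.

(** [delta2] is local at 0, so a first constraint on [d] confines all coordinates to [[0, r]]. There
    [phi (2 ^+ M * v) <= K * phi v], and [d <= K^-1] brings the modular of [2 ^+ M] times [x] to at
    most 1. *)
Lemma delta2_modular_small : delta2 phi -> forall e : R, (0 < e)%R ->
  exists2 d : R, (0 < d)%R & forall x, modular phi w x <= d%:E ->
    (luxemburg_norm phi w x <= e)%R.
Proof.
move=> /delta2_iter d2 e e0.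
have [M Me] : exists M, (2^-1 ^+ M <= e)%R.
  have : (((2^-1 : R) ^+ n)%R @[n --> \oo] --> 0%R).
    by apply: cvg_expr; rewrite ger0_norm ?invr_ge0// invf_lt1// ltr1n.
  move=> /cvgrPdist_lt/(_ e e0)[n _ /(_ n (leqnn n))].
  rewrite sub0r normrN ger0_norm ?exprn_ge0 ?invr_ge0// => h.
  by exists n; exact: ltW.
have [K [r [K0 r0 rP]]] := d2 M.
have [q q0 qr] := orlicz_pos_lb phi r0.
have w0 := weight_gt0 w 0.
exists (Num.min (q * w 0%N / 2) K^-1)%R; first by rewrite lt_min !divr_gt0 ?mulr_gt0 ?invr_gt0.
move=> x xd; apply: le_trans Me; apply: luxemburg_norm_le.
  by rewrite exprn_gt0 ?invr_gt0.
rewrite -exprVn invrK.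
have xr k : (cabs (x k) <= r)%R.
  rewrite leNgt; apply/negP => rx.
  have := le_trans (orlicz_le_modular phi w x k) xd.
  have : (q * w 0%N)%:E <= phi (cabs (x k)) * (w 0%N)%:E.
    rewrite EFinM; apply: lee_wpmul2r; first by rewrite lee_fin ltW.
    by apply: le_trans qr _; apply: orlicz_mono; exact: ltW.
  move=> /le_trans h /h; rewrite lee_fin le_min => /andP[+ _].
  by rewrite leNgt ltr_pdivrMr// mulr_natr mulr2n ltrDl mulr_gt0.
apply: modular_le_sums => N sg inj.
apply: (@le_trans _ _ (\sum_(n < N) K%:E * (phi (cabs (x (sg n))) * (w n)%:E))).
  apply: lee_sum => n _; rewrite muleA; apply: lee_wpmul2r.
    by rewrite lee_fin ltW// weight_gt0.
  rewrite cabsZr ?exprn_ge0//; apply: rP; rewrite cabs_ge0; exact: xr.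
rewrite -ge0_sume_distrr; last first.
  by move=> n _; exact: weighted_orlicz_ge0.
have inj' : {in `I_N &, injective sg} by move=> ? ? _ _; exact: inj.
apply: (@le_trans _ _ (K%:E * (K^-1)%:E)).
  apply: lee_wpmul2l; first by rewrite lee_fin ltW.
  apply: le_trans (sum_le_modular phi w x inj') _; apply: le_trans xd _.
  by rewrite lee_fin ge_min lexx orbT.
by rewrite -EFinM divff// gt_eqF.
Qed.

End orlicz.

(** * Approximation by finitely supported sequences *)

Section approximation.
Context {R : realType} (phi : orlicz_function R) (w : weight_sequence R).
Implicit Types (x u v : nat -> R[i]) (s : seq nat) (sg ta : nat -> nat).
Local Open Scope ereal_scope.

Lemma sum_in_le s sg N (c : R) : injective sg -> (0 <= c)%R ->
  (\sum_(j < N) (if sg j \in s then c else 0) <= (size s)%:R * c)%R.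
Proof.
move=> inj c0; rewrite -big_mkcond /= sumr_const mulr_natl; apply: ler_wpMn2l => //.
rewrite cardE -(size_map (fun j : 'I_N => sg j)); apply: uniq_leq_size.
  by rewrite map_inj_uniq ?enum_uniq// => i j /inj /val_inj.
by move=> k /mapP[j]; rewrite mem_enum => js ->.
Qed.

(** Applied to [u = x - a] and [v = x], with [s] the support of [a]. Squares are bounded on [s]
    because the peak function controls a sum of squares. *)
Lemma near_finite_support_small s (e : R) : delta2 phi -> (0 < e)%R ->
  exists2 d : R, (0 < d)%R & forall u v,
    (forall k, k \in s -> (cabs (u k) ^+ 2 <= d)%R) ->
    (forall k, k \notin s -> u k = v k) ->
    (forall N ta, {in `I_N &, injective ta} -> (forall j, (j < N)%N -> ta j \notin s) ->
      \sum_(j < N) phi (cabs (v (ta j))) * (w (size s + j)%N)%:E <= d%:E) ->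
    (luxemburg_norm phi w u <= e)%R.
Proof.
move=> d2 e0; have [dA dA0 dAP] := delta2_modular_small w d2 e0.
set m := size s; have w0 := weight_gt0 w 0; have wm := weight_gt0 w m.
have W0 : (0 < 1 + m%:R * (w 0%N / w m))%R.
  by rewrite ltr_pwDl// mulr_ge0// divr_ge0// ltW.
(* The denominator pays for the loss in [shifted_sums_le_modular]. Half of [d1] goes to the terms in
   [s], at most [m] of them, and half to the tail. *)
pose d1 := (dA / (1 + m%:R * (w 0%N / w m)))%R.
have d10 : (0 < d1)%R by rewrite divr_gt0.
have m1 : (0 < m%:R * w 0%N + 1)%R by rewrite ltr_wpDl// mulr_ge0// ltW.
pose ka := (d1 / 2 / (m%:R * w 0%N + 1))%R.
have ka0 : (0 < ka)%R by rewrite !divr_gt0.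
have [r r0 rP] := orlicz_small phi ka0.
exists (Num.min (d1 / 2) (r ^+ 2))%R; first by rewrite lt_min divr_gt0//= exprn_gt0.
move=> u v us uv sv; apply: dAP.
have -> : dA = (d1 * (1 + m%:R * (w 0%N / w m)))%R by rewrite divfK// gt_eqF.
apply: shifted_sums_le_modular => N sg inj.
have [ta inj' taP] := avoid_injective s N inj.
have term (j : 'I_N) : phi (cabs (u (sg j))) * (w (m + j)%N)%:E <=
    (if sg j \in s then ka * w 0%N else 0)%:E + phi (cabs (v (ta j))) * (w (m + j)%N)%:E.
  have wj := weight_gt0 w (m + j).
  have [taj taE] := taP j (ltn_ord j); case: ifP => [js|/negbT js].
    rewrite -[leLHS]adde0; apply: leeD; last exact: weighted_orlicz_ge0.
    rewrite EFinM; apply: lee_pmul; rewrite ?orlicz_ge0 ?lee_fin ?(ltW wj) ?weight_nonincreasing//.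
    apply: rP; rewrite ger0_norm ?cabs_ge0// -ler_sqr ?nnegrE ?cabs_ge0 ?(ltW r0)//.
    by apply: le_trans (us _ js) _; rewrite ge_min lexx orbT.
  by rewrite add0e uv// taE.
apply: le_trans (lee_sum _ (fun j _ => term j)) _.
rewrite big_split /= sumEFin (_ : d1 = d1 / 2 + d1 / 2)%R; last by lra.
rewrite EFinD; apply: leeD; last first.
  apply: (@le_trans _ _ (Num.min (d1 / 2) (r ^+ 2))%:E); last by rewrite lee_fin ge_min lexx.
  by apply: sv => // j jN; exact: (taP j jN).1.
rewrite lee_fin; apply: le_trans (sum_in_le _ _ inj _) _; first by rewrite mulr_ge0// ltW.
rewrite -/m mulrCA /ka -[leRHS]mulr1 -[X in (X <= _)%R]mulrA; apply: ler_wpM2l.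
  by rewrite divr_ge0// ltW.
by rewrite mulrC ler_pdivrMr// mul1r lerDl.
Qed.

Definition truncate n x : nat -> R[i] := fun k => if (k < n)%N then x k else 0%R.

Lemma truncate_orlicz_lorentz n x :
  orlicz_lorentz_set phi w x -> orlicz_lorentz_set phi w (truncate n x).
Proof.
move=> [l l0 xl]; exists l; first exact: l0.
apply: le_lt_trans xl; apply: modular_mono => k.
rewrite !cabsZr ?(ltW l0)//; rewrite /truncate; case: ifP => // _.
by rewrite ComplexField.Normc.normc0 mulr0 mulr_ge0 ?cabs_ge0 ?(ltW l0).
Qed.

(** The modular of a tail is not the remainder of a series, since rearranging brings the tail back
    to the large weights. A sum over the tail is therefore cut at [N]: its first [N] terms are small
    because far coordinates are, and the others extend an injection [sg] that is optimal up to
    [d / 2], which leaves them at most [d / 2]. *)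
Lemma modular_tail_small x (d : R) : modular phi w x < +oo -> (0 < d)%R ->
  exists n, modular phi w (x - truncate n x)%R <= d%:E.
Proof.
move=> xoo d0; set M := modular phi w x in xoo.
have M0 : 0 <= M by exact: modular_ge0.
have ME : M = (fine M)%:E by rewrite fineK// ge0_fin_numE.
have [N [sg inj sgM]] : exists N, exists2 sg : nat -> nat, injective sg &
    (fine M - d / 2)%:E < \sum_(i < N) phi (cabs (x (sg i))) * (w i)%:E.
  apply: contrapT => h.
  have : M <= (fine M - d / 2)%:E.
    apply: modular_le_sums => N sg inj; rewrite leNgt; apply/negP => lt.
    by apply: h; exists N; exists sg.
  by rewrite {1}ME lee_fin; lra.
have N1 : (0 < N%:R * w 0%N + 1)%R by rewrite ltr_wpDl// mulr_ge0// ltW// weight_gt0.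
have ka0 : (0 < d / 2 / (N%:R * w 0%N + 1))%R by rewrite !divr_gt0.
have [r r0 rP] := orlicz_small phi ka0.
have [n1 n1P] : exists n, forall k, (n <= k)%N -> (cabs (x k) <= r)%R.
  by apply: (@coordinate_vanishes _ phi w x (fine M)) r0; rewrite -ME.
(* From [n] on, coordinates are at most [r] and lie outside the first [N] values of [sg]. *)
pose n := (n1 + (\sum_(i < N) sg i).+1)%N.
exists n; set u := (x - _)%R.
have uE k : u k = if (k < n)%N then 0%R else x k.
  rewrite (_ : u k = x k - truncate n x k)%R// /truncate.
  by case: ifP => _; rewrite ?subrr ?subr0.
have ux k : (cabs (u k) <= cabs (x k))%R.
  by rewrite uE; case: ifP => // _; rewrite ComplexField.Normc.normc0 cabs_ge0.
apply: modular_le_sums => K ta injt.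
apply: (@le_trans _ _ (\sum_(j < N + K) phi (cabs (u (ta j))) * (w j)%:E)).
  rewrite [leRHS](_ : _ = \sum_(j < K + N) phi (cabs (u (ta j))) * (w j)%:E); last by rewrite addnC.
  rewrite big_split_ord /= leeDl// sume_ge0// => i _.
  exact: weighted_orlicz_ge0.
rewrite big_split_ord /= (_ : d = d / 2 + d / 2)%R; last by lra.
rewrite EFinD; apply: leeD.
  apply: (@le_trans _ _ (\sum_(i < N) (d / 2 / (N%:R * w 0%N + 1) * w 0%N)%:E)).
    apply: lee_sum => i _; rewrite EFinM; have wi := weight_gt0 w i.
    apply: lee_pmul; rewrite ?orlicz_ge0 ?lee_fin ?(ltW wi) ?weight_nonincreasing//.
    apply: rP; rewrite ger0_norm ?cabs_ge0// uE; case: ifP => [_|/negbT].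
      by rewrite ComplexField.Normc.normc0 ltW.
    by rewrite -leqNgt => h; apply: n1P; rewrite /n in h; lia.
  rewrite sumEFin sumr_const card_ord lee_fin -[X in (X <= _)%R]mulr_natl mulrCA -[leRHS]mulr1 -[X in (X <= _)%R]mulrA.
  apply: ler_wpM2l; first by rewrite divr_ge0// ltW.
  by rewrite mulrC ler_pdivrMr// mul1r lerDl.
have injN : injective (fun j => ta (N + j)%N) by move=> i j /injt; lia.
have [ta' inj' taP] := avoid_injective (iota 0 n) K injN.
have disj i j : (i < N)%N -> (j < K)%N -> sg i <> ta' j.
  move=> iN jK h; have := (taP j jK).1; rewrite mem_iota -h add0n /=.
  have := le_sum_ord sg iN; rewrite /n; lia.
have injs : {in `I_N &, injective sg} by move=> ? ? _ _; exact: inj.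
have := sum_cat_le_modular phi w x injs inj' disj; rewrite -/M ME.
set S := \sum_(i < N) _ in sgM *; set T := \sum_(j < K) _ => ST.
have : T <= (d / 2)%:E.
  have S0 : 0 <= S by apply: sume_ge0 => i _; exact: weighted_orlicz_ge0.
  have T0 : 0 <= T by apply: sume_ge0 => i _; exact: weighted_orlicz_ge0.
  case: S S0 sgM ST => [S'||]//; case: (T) T0 => [T'||]//.
  by rewrite !lte_fin -EFinD !lee_fin => _ _ h1 h2; lra.
apply: le_trans; apply: lee_sum => j _; apply: lee_wpmul2r.
  by rewrite lee_fin ltW// weight_gt0.
have [_ taE] := taP j (ltn_ord j); rewrite mem_iota add0n /= in taE.
rewrite uE; case: ifP => [_|/negbT jn]; last by rewrite taE.
by rewrite ComplexField.Normc.normc0 orlicz0 orlicz_ge0.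
Qed.

End approximation.

Section orlicz_lorentz_space.
Context {R : realType} (phi : orlicz_function R) (w : weight_sequence R).
Local Notation X := (orlicz_lorentz phi w).
Implicit Types (x y a : X).

Lemma orlicz_lorentz_rnorm x : rnorm x = luxemburg_norm phi w x.
Proof. by rewrite /rnorm orlicz_lorentz_normE. Qed.

Lemma orlicz_lorentz_modular_le1 x : rnorm x <= 1 -> (modular phi w x <= 1)%E.
Proof. by rewrite orlicz_lorentz_rnorm; apply: modular_le1; exact: set_mem (ol_seqP x). Qed.

Lemma ol_seqB x y k : (x - y) k = x k - y k.
Proof. by []. Qed.

Lemma ol_seqZ (c : R[i]) x k : (c *: x) k = c * x k.
Proof. by []. Qed.

Lemma normalize x : x != 0 -> rnorm ((rnorm x)^-1%:C *: x) = 1.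
Proof.
move=> x0; have xp : 0 < rnorm x.
  by rewrite lt_def rnorm_ge0 andbT; apply: contra x0 => /eqP/rnorm_eq0 ->.
by rewrite rnormZ cabs_real ?invr_ge0 ?(ltW xp)// mulVf// gt_eqF.
Qed.

Lemma unit_element_exists : exists x, unit_sphere X x.
Proof.
pose d0 : nat -> R[i] := fun k => if k is 0%N then 1 else 0.
have [r r0 rP] := orlicz_small phi (@ltr01 R).
have d0X : orlicz_lorentz_set phi w d0.
  exists r => //; apply: (@le_lt_trans _ _ (w 0%N)%:E); last exact: ltry.
  apply: modular_le_sums => N sg inj.
  apply: (@le_trans _ _ (\sum_(j < N) (if sg j \in [:: 0%N] then w 0%N else 0)%:E)%E).
    apply: lee_sum => j _; rewrite cabsZr ?(ltW r0)// mem_seq1.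
    case: eqP => [->|]; last first.
      by case: (sg j) => // k _; rewrite [cabs _]ComplexField.Normc.normc0 mulr0 orlicz0 mul0e.
    rewrite [cabs _]ComplexField.Normc.normc1 mulr1 -[leRHS]mul1e; apply: lee_pmul; rewrite ?orlicz_ge0//.
    - by rewrite lee_fin ltW// weight_gt0.
    - by apply: rP; rewrite gtr0_norm.
    - by rewrite lee_fin weight_nonincreasing.
  rewrite sumEFin lee_fin; apply: le_trans (sum_in_le _ _ inj _) _; first by rewrite ltW// weight_gt0.
  by rewrite mul1r.
have d0P : d0 \in orlicz_lorentz_pred phi w by rewrite inE.
pose x : X := OrliczLorentz d0P.
have x0 : x != 0.
  apply/eqP => /(congr1 (fun y : X => ol_seq y 0%N)) /= /eqP.
  by rewrite oner_eq0.
by exists ((rnorm x)^-1%:C *: x); apply/unit_sphereE; exact: normalize.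
Qed.

Lemma finite_support_dense x (e : R) : delta2 phi -> rnorm x = 1 -> 0 < e ->
  exists a n, [/\ forall k, (n <= k)%N -> a k = 0, rnorm a = 1 & rnorm (x - a) < e].
Proof.
(* Truncation costs [e1], and so does normalisation, as the norm of [y] is within [e1] of 1; the
   bound [1 / 2] keeps [y] nonzero. *)
move=> d2 x1 e0; pose e1 := Num.min (e / 4) (1 / 2).
have e10 : 0 < e1 by rewrite lt_min !divr_gt0.
have e1e : e1 <= e / 4 by rewrite ge_min lexx.
have e12 : e1 <= 1 / 2 by rewrite ge_min lexx orbT.
have [d d0 dP] := delta2_modular_small w d2 e10.
have xoo : (modular phi w x < +oo)%E.
  by apply: le_lt_trans (ltry 1); apply: orlicz_lorentz_modular_le1; rewrite x1.
have [n nP] := modular_tail_small xoo d0.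
have yP : truncate n x \in orlicz_lorentz_pred phi w.
  by rewrite inE; apply: truncate_orlicz_lorentz; exact: set_mem (ol_seqP x).
pose y : X := OrliczLorentz yP.
have xy : rnorm (x - y) <= e1 by rewrite orlicz_lorentz_rnorm; exact: dP.
have /andP[y1 y1'] := rnorm_dist_bounds xy; rewrite x1 in y1 y1'.
have yp : 0 < rnorm y by apply: lt_le_trans y1; clear -e12; lra.
have y0 : y != 0 by apply: contraTneq yp => ->; rewrite /rnorm normr0 ltxx.
exists ((rnorm y)^-1%:C *: y), n; split.
- by move=> k nk; rewrite ol_seqZ /= /truncate ltnNge nk mulr0.
- exact: normalize.
have ya : rnorm (y - (rnorm y)^-1%:C *: y) <= e1.
  rewrite -[X in X - _]scale1r -scalerBl rnormZ -(rmorph1 (real_complex R)) -rmorphB /=.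
  rewrite expr0n /= addr0 sqrtr_sqr -[X in _ * X]gtr0_norm// -normrM mulrBl mul1r mulVf ?gt_eqF//.
  move: (rnorm y) y1 y1' => r r1 r2.
  by rewrite ler_norml; clear -r1 r2; apply/andP; split; lra.
apply: le_lt_trans (rnorm_dist_triangle x y _) _.
by apply: le_lt_trans (lerD xy ya) _; clear -e0 e1e; lra.
Qed.

End orlicz_lorentz_space.

(** * Peak functions at finitely supported points *)

Section peak.
Context {R : realType}.

(** The real part of -eta (z - al)^2 is -eta |z - al|^2 + 2 eta y^2 with y = Im z. The excess is
    paid by the gap c (|z| - Re z) of the linear term, as y^2 = (|z| - Re z)(|z| + Re z) is at most
    2 C (|z| - Re z). *)
Lemma peak_coordinate (z : R[i]) (c al eta C : R) : 0 <= eta -> cabs z <= C ->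
  4 * C * eta <= c ->
  complex.Re (c%:C * z + (- eta)%:C * ((z - al%:C) * (z - al%:C))) <=
  c * cabs z - eta * cabs (z - al%:C) ^+ 2.
Proof.
move=> eta0 zC cC; rewrite cabs_sqr.
have xN : complex.Re z <= cabs z by apply: le_trans (ler_norm _) (Re_le_cabs z).
have := cabs_sqr z; have := cabs_ge0 z; move: (cabs z) zC xN => N NC xN N0.
case: z xN => x y /= xN NE.
have y2 : y ^+ 2 <= 2 * C * (N - x).
  have -> : y ^+ 2 = (N + x) * (N - x) by rewrite mulrC -subr_sqr NE; ring.
  by apply: ler_wpM2r; lra.
have : eta * y ^+ 2 <= eta * (2 * C * (N - x)) by rewrite ler_wpM2l.
have : 4 * C * eta * (N - x) <= c * (N - x) by apply: ler_wpM2r => //; lra.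
by lra.
Qed.

Lemma common_lower_bound (c : nat -> R) m : (forall i, 0 < c i) ->
  exists2 eta, 0 < eta & forall i, (i < m)%N -> eta <= c i.
Proof.
move=> c0; elim: m => [|m [eta eta0 etac]]; first by exists 1.
exists (Num.min eta (c m)); first by rewrite lt_min eta0 c0.
move=> i; rewrite ltnS leq_eqVlt ge_min => /orP[/eqP ->|/etac ->//].
by rewrite lexx orbT.
Qed.

Context (phi : orlicz_function R) (w : weight_sequence R).
Local Notation X := (orlicz_lorentz phi w).

Definition coordinate k (x : X) : R[i]^o := x k.

Lemma coordinate_is_linear k : linear (coordinate k).
Proof. by []. Qed.

HB.instance Definition _ k :=
  GRing.isLinear.Build R[i] X R[i]^o *:%R (coordinate k) (coordinate_is_linear k).

Lemma lipschitz_diff_coordinate k : lipschitz_diff (coordinate k).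
Proof.
have [C C0 CP] := coordinate_bound phi w.
apply: (@lipschitz_diff_linear _ _ (coordinate k) C) => x x1.
by apply: CP; exact: orlicz_lorentz_modular_le1.
Qed.

(* With [c_i] the weighted slopes of [phi] at the values of [a], the modular gives
   [\sum_i c_i (|x_i| - |a_i|) + tail <= 0] on the unit ball. *)
Lemma support_inequality (a : X) (s : seq nat) : uniq s ->
  (forall k, (k \in s) = (a k != 0)) -> rnorm a <= 1 ->
  (1 <= \sum_(i < size s) phi (cabs (a (nth 0%N s i))) * (w i)%:E)%E ->
  exists2 c : nat -> R, (forall i, 0 < c i) & forall x : X, rnorm x <= 1 ->
    forall N ta, {in `I_N &, injective ta} ->
    (forall j, (j < N)%N -> ta j \notin s) ->
    ((\sum_(i < size s) c i * (cabs (x (nth 0%N s i)) - cabs (a (nth 0%N s i))))%:E +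
     \sum_(j < N) phi (cabs (x (ta j))) * (w (size s + j)%N)%:E <= 0)%E.
Proof.
move=> us mems a1 sum1; set m := size s in sum1 *.
pose al i := cabs (a (nth 0%N s i)).
have w0 := weight_gt0 w.
have aloo i : (phi (al i) < +oo)%E.
  have := le_trans (orlicz_le_modular phi w a (nth 0%N s i)) (orlicz_lorentz_modular_le1 a1).
  rewrite -/(al i); have := orlicz_ge0 phi (al i); case: (phi _) => [r||]// _.
    by rewrite ltry.
  by rewrite gt0_mulye ?lte_fin.
have slope i : exists p : R, 0 < p /\ ((i < m)%N -> forall v, 0 <= v ->
    ((fine (phi (al i)) + p * (v - al i))%:E <= phi v)%E).
  have [im|mi] := ltnP i m; last by exists 1.
  have ai0 : 0 < al i.
    rewrite lt_def cabs_ge0 andbT; have : nth 0%N s i \in s by rewrite mem_nth.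
    by rewrite mems; apply: contra => /eqP/ComplexField.Normc.eq0_normc ->.
  by have [p p0 pP] := subgradient ai0 (aloo i); exists p.
have [p pP] := choice slope.
exists (fun i => p i * w i) => [i|x x1 N ta injt tas]; first by rewrite mulr_gt0 ?(pP i).1.
have injs : {in `I_m &, injective (nth 0%N s)}.
  by move=> i j; rewrite !inE /= => im jm /eqP; rewrite nth_uniq// => /eqP.
have disj i j : (i < m)%N -> (j < N)%N -> nth 0%N s i <> ta j.
  by move=> im jN h; have := tas j jN; rewrite -h mem_nth.
have := sum_cat_le_modular phi w x injs injt disj.
move=> /le_trans/(_ (orlicz_lorentz_modular_le1 x1)).
set T := (\sum_(j < N) _)%E => xT.
have T0 : (0 <= T)%E.
  by apply: sume_ge0 => j _; exact: weighted_orlicz_ge0.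
pose S := \sum_(i < m) (p i * w i * (cabs (x (nth 0%N s i)) - al i)).
(* The values of [phi] at [a] alone sum to at least 1, and the modular of [x] is at most 1: only
   slopes and tail remain. *)
have : ((1 + S)%:E + T <= 1)%E.
  apply: le_trans xT; apply: leeD => //.
  apply: (@le_trans _ _ (\sum_(i < m)
      (fine (phi (al i)) * w i + p i * w i * (cabs (x (nth 0%N s i)) - al i))%:E)%E).
    rewrite sumEFin big_split /= !EFinD; apply: leeD => //.
    rewrite -sumEFin; apply: le_trans sum1 _; apply: lee_sum => i _.
    by rewrite EFinM fineK// ge0_fin_numE ?orlicz_ge0.
  apply: lee_sum => i _.
  rewrite (mulrAC (p i)) -mulrDl EFinM.
  apply: lee_wpmul2r; first by rewrite lee_fin ltW.
  by apply: (pP i).2 => //; exact: cabs_ge0.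
move=> ST; suff : (S%:E + T <= 0)%E by [].
move: (S) (T) T0 ST; clear => r [t||]//; rewrite -!EFinD !lee_fin; lra.
Qed.

Lemma finite_support_peak (a : X) n (e : R) : delta2 phi ->
  (forall k, (n <= k)%N -> a k = 0) -> rnorm a = 1 -> 0 < e ->
  exists f : X -> R[i]^o, exists q : R, [/\ lipschitz_diff f, q < cabs (f a) &
    forall x, rnorm x <= 1 -> e <= rnorm (x - a) -> cabs (f x) <= q].
Proof.
move=> d2 an a1 e0.
have [s [us mems asum]] := sorted_support phi w an.
have sum1 : (1 <= \sum_(i < size s) phi (cabs (a (nth 0%N s i))) * (w i)%:E)%E.
  by apply: unit_support_sum asum _; rewrite -orlicz_lorentz_rnorm a1.
have a1' : rnorm a <= 1 by rewrite a1.
have [c c0 cP] := support_inequality us mems a1' sum1.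
set m := size s in sum1 cP.
pose al i := cabs (a (nth 0%N s i)).
pose u i := (al i)%:C / a (nth 0%N s i).
have as0 i : (i < m)%N -> a (nth 0%N s i) != 0 by move=> im; rewrite -mems mem_nth.
have u1 i : (i < m)%N -> cabs (u i) = 1.
  move=> /as0 ai; rewrite /u ComplexField.Normc.normcM ComplexField.Normc.normcV.
  rewrite cabs_real ?cabs_ge0// divff//.
  by apply: contra ai => /eqP/ComplexField.Normc.eq0_normc ->.
have ua i : (i < m)%N -> u i * a (nth 0%N s i) = (al i)%:C.
  by move=> /as0 ai; rewrite /u divfK.
have [C C0 CP] := coordinate_bound phi w.
(* Secures the condition [4 * C * eta <= c i] of [peak_coordinate] for all [i < m] at once. *)
have [eta eta0 etaP] := @common_lower_bound (fun i => c i / (4 * C)) m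
  (fun i => divr_gt0 (c0 i) (mulr_gt0 (ltr0Sn _ 3) C0)).
pose F i (x : X) : R[i]^o := (c i)%:C * (u i * coordinate (nth 0%N s i) x) +
  (- eta)%:C * ((u i * coordinate (nth 0%N s i) x - (al i)%:C) *
                (u i * coordinate (nth 0%N s i) x - (al i)%:C)).
pose f0 x : R[i]^o := \sum_(i <- iota 0 m) F i x.
have lipF i : lipschitz_diff (F i).
  have lu : lipschitz_diff (fun x => u i * coordinate (nth 0%N s i) x : R[i]^o).
    by apply: lipschitz_diffM (lipschitz_diff_coordinate _); exact: lipschitz_diff_cst.
  apply: lipschitz_diffD; first exact: lipschitz_diffM (lipschitz_diff_cst _) lu.
  apply: lipschitz_diffM; first exact: lipschitz_diff_cst.
  by apply: lipschitz_diffM; apply: lipschitz_diffD lu (lipschitz_diff_cst _).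
have lip0 : lipschitz_diff f0 by apply: lipschitz_diff_sum => i _; exact: lipF.
pose psi := \sum_(i < m) c i * al i.
have f0E x : f0 x = \sum_(i < m) F i x.
  by rewrite /f0 -(big_mkord xpredT (fun i => F i x)) /index_iota subn0.
have f0a : f0 a = psi%:C.
  rewrite f0E /psi rmorph_sum /=; apply: eq_bigr => i _.
  by rewrite /F /coordinate ua// subrr !mulr0 addr0 rmorphM.
have psi0 : 0 <= psi by apply: sumr_ge0 => i _; rewrite mulr_ge0 ?cabs_ge0 ?(ltW (c0 i)).
pose Q x := \sum_(i < m) cabs (x (nth 0%N s i) - a (nth 0%N s i)) ^+ 2.
have Re0 (x : X) : rnorm x <= 1 -> complex.Re (f0 x) <=
    psi + \sum_(i < m) c i * (cabs (x (nth 0%N s i)) - al i) - eta * Q x.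
  move=> x1; rewrite f0E raddf_sum /psi /Q mulr_sumr -sumrN -!big_split /=.
  apply: ler_sum => i _.
  have xi : cabs (u i * x (nth 0%N s i)) = cabs (x (nth 0%N s i)).
    by rewrite ComplexField.Normc.normcM u1// mul1r.
  have uxa : cabs (u i * x (nth 0%N s i) - (al i)%:C) =
      cabs (x (nth 0%N s i) - a (nth 0%N s i)).
    by rewrite -ua// -mulrBr ComplexField.Normc.normcM u1// mul1r.
  have xC : cabs (u i * x (nth 0%N s i)) <= C.
    by rewrite xi; apply: CP; exact: orlicz_lorentz_modular_le1.
  have := etaP i (ltn_ord i); rewrite ler_pdivlMr ?mulr_gt0// mulrC => ec.
  have := peak_coordinate (al i) (ltW eta0) xC ec; rewrite xi uxa /F /coordinate.
  by move=> h; apply: le_trans h _; rewrite mulrBr addrCA subrr addr0.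
have e2 : 0 < e / 2 by rewrite divr_gt0.
have [d d0 dP] := near_finite_support_small w s d2 e2.
(* A real part above [psi - de] forces [- de < S], hence a tail at most [d], and [eta * Q x < de],
   hence [Q x <= d]. *)
pose de := Num.min d (eta * d).
have de0 : 0 < de by rewrite lt_min d0 mulr_gt0.
have far (x : X) : rnorm x <= 1 -> e <= rnorm (x - a) ->
    complex.Re (f0 x) <= psi - de.
  move=> x1 ex; rewrite leNgt; apply/negP => lt; move: ex; rewrite leNgt => /negP; apply.
  rewrite orlicz_lorentz_rnorm; apply: (@le_lt_trans _ _ (e / 2)).
    have Q0 : 0 <= Q x by apply: sumr_ge0 => i _; rewrite sqr_ge0.
    have etaQ : 0 <= eta * Q x by rewrite mulr_ge0// ltW.
    have RE := lt_le_trans lt (Re0 x x1).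
    set S := \sum_(i < m) _ in RE; clearbody psi.
    have Sde : - de < S by clear -RE etaQ; lra.
    have S0 : S <= 0.
      (* [N = 0] leaves the slopes without a tail. *)
      have := cP x x1 0%N id; rewrite big_ord0 adde0 lee_fin; apply=> //.
    have Qde : eta * Q x < de by clear -RE S0; lra.
    apply: (dP (ol_seq (x - a)) (ol_seq x)).
    - move=> k ks; rewrite ol_seqB.
      have ik : (index k s < m)%N by rewrite index_mem.
      have : eta * Q x <= eta * d by apply: (le_trans (ltW Qde)); rewrite ge_min lexx orbT.
      rewrite ler_pM2l// => Qd; apply: le_trans Qd.
      rewrite /Q (bigD1 (Ordinal ik))//= nth_index// lerDl.
      by apply: sumr_ge0 => i _; rewrite sqr_ge0.
    - move=> k; rewrite mems negbK => /eqP ak.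
      by rewrite ol_seqB ak subr0.
    - move=> N ta injt tas; have := cP x x1 N ta injt tas.
      set T := (\sum_(j < N) _)%E.
      have T0 : (0 <= T)%E.
        by apply: sume_ge0 => j _; exact: weighted_orlicz_ge0.
      have ded : de <= d by rewrite ge_min lexx.
      rewrite -/S; case: (T) T0 => [t||]//; rewrite -?EFinD !lee_fin.
      by clear -Sde ded; lra.
  by clear -e0; lra.
have [_ [L [L0 [f0L _]]]] := lip0.
(* As |K + g|^2 = K^2 + 2 K Re g + |g|^2, passing from real parts to moduli loses at most [L ^+ 2],
   while the gap [de] gains [2 * K * de]; this [K] makes the gain exceed the loss by 1. *)
pose K := (L ^+ 2 + 1) / (2 * de).
have K0 : 0 < K by rewrite divr_gt0 ?mulr_gt0// ltr_wpDl// sqr_ge0.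
have Kde : 2 * K * de = L ^+ 2 + 1.
  by rewrite /K; field; rewrite gt_eqF.
exists (fun x => K%:C + f0 x), (Num.sqrt (K ^+ 2 + 2 * K * (psi - de) + L ^+ 2)); split.
- by apply: lipschitz_diffD lip0; exact: lipschitz_diff_cst.
- rewrite f0a -rmorphD cabs_real; last by rewrite addr_ge0// ltW.
  have Kp : 0 < K + psi by rewrite ltr_pwDl.
  rewrite -[ltRHS]gtr0_norm// -sqrtr_sqr ltr_sqrt ?exprn_gt0//.
  by have := sqr_ge0 psi; clear -Kde; lra.
- move=> x x1 ex; have := far x x1 ex; have := f0L x x1.
  rewrite -ler_sqr ?nnegrE ?cabs_ge0// => fL fR.
  rewrite -[leLHS]ger0_norm ?cabs_ge0// -sqrtr_sqr ler_wsqrtr//.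
  have : K * complex.Re (f0 x) <= K * (psi - de) by rewrite ler_wpM2l// ltW.
  move: fL; rewrite !cabs_sqr; case: (f0 x) => g h /=; rewrite add0r.
  by clear; lra.
Qed.

End peak.

Theorem corollary3p7 (R : realType) (phi : orlicz_function R)
    (w : weight_sequence R) (hphi : delta2 phi) :
  [/\ shilov_exists (algebra_u (orlicz_lorentz phi w)),
      shilov_exists (algebra_b (orlicz_lorentz phi w)),
      shilov (algebra_u (orlicz_lorentz phi w)) =
        shilov (algebra_b (orlicz_lorentz phi w))
    & shilov (algebra_b (orlicz_lorentz phi w)) =
        unit_sphere (orlicz_lorentz phi w)].
Proof.
apply: shilov_unit_sphere; first exact: unit_element_exists.
move=> F cF bF x /unit_sphereE x1; rewrite (closure_id F).1//.
move=> U /nbhs_rnorm[e e0 eU].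
have e2 : 0 < e / 2 by rewrite divr_gt0.
have [a [n [an a1 xa]]] := finite_support_dense hphi x1 e2.
have [f [q [lf qf far]]] := finite_support_peak hphi an a1 e2.
have a1' : rnorm a <= 1 by rewrite a1.
have [y Fy ya] := peak_meets_boundary bF lf a1' qf far.
exists y; split=> //; apply: eU; apply: le_lt_trans (rnorm_dist_triangle x a y) _.
rewrite -[rnorm (a - y)]rnormN opprB; apply: lt_le_trans (ltrD xa ya) _.
by clear; lra.
Qed.
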